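(* Every finitely generated rank $1$ torsion-free module $M$ over the Weyl algebra $A$ has an $A_\infty$-envelope: there exist a unital two-term $A_\infty$-module $\boldsymbol K=K^0\oplus K^1$ over $A$ satisfying axioms (E1)--(E3) and an $A_\infty$-quasi-isomorphism $r:M\to\boldsymbol K$.
   Context: Let $k$ be an algebraically closed field of characteristic zero and $A=A_1(k)=k\langle x,y\rangle/(xy-yx-1)$ the first Weyl algebra, with fixed generators $x,y$. Modules are right modules. A unital two-term (right) $A_\infty$-module over $A$ is a graded vector space $\boldsymbol K=K^0\oplus K^1$ (degrees $0,1$) with linear maps $m_1:K^0\to K^1$, $m_2^0:K^0\otimes A\to K^0$, $m_2^1:K^1\otimes A\to K^1$, $m_3:K^1\otimes A\otimes A\to K^0$ (all other operations vanish for degree reasons) such that for $u\in K^0$, $v\in K^1$, $a,b,c\in A$: $m_1(m_2^0(u,a))=m_2^1(m_1(u),a)$; $m_2^0(m_2^0(u,a),b)-m_2^0(u,ab)=m_3(m_1(u),a,b)$; $m_2^1(m_2^1(v,a),b)-m_2^1(v,ab)=m_1(m_3(v,a,b))$; $-m_3(v,ab,c)+m_3(v,a,bc)+m_3(m_2^1(v,a),b,c)-m_2^0(m_3(v,a,b),c)=0$; and $m_2^0(u,1)=u$, $m_2^1(v,1)=v$, $m_3(v,1,a)=m_3(v,a,1)=0$. The cohomology $H^0(\boldsymbol K)=\ker m_1$, $H^1(\boldsymbol K)=\mathrm{coker}\,m_1$ are $A$-modules via $m_2$. An $A$-module $M$ is regarded as an $A_\infty$-module concentrated in degree $0$ with $m_2$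 the given action and $m_1=m_3=0$. For such $M$, an $A_\infty$-quasi-isomorphism $r:M\to\boldsymbol K$ is (necessarily strict) a linear map $r:M\to K^0$ with $m_1r=0$ and $r(ma)=m_2^0(r(m),a)$, inducing an isomorphism $M\cong\ker m_1=H^0(\boldsymbol K)$ and such that $H^1(\boldsymbol K)=0$ (i.e. $m_1$ is surjective). Axioms: (E1) $\dim_kK^1<\infty$; (E2) there is $i\in K^0$ such that $m_2^0(i,-):A\to K^0$ is an isomorphism of vector spaces; (E3) for all $a\in A$, $v\in K^1$: $m_3(v,x,a)=0$, $m_3(v,a,y)=0$, and $m_3(v,y,x)\in k\,i$. *)

(* Defs.v *)
From HB Require Import structures.
From mathcomp Require Import all_boot all_algebra generic_quotient ring_quotient.
From mathcomp Require Import finmap.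
From mathcomp Require Import boolp.
From mathcomp Require Import monalg.

Set Implicit Arguments.
Unset Strict Implicit.
Unset Printing Implicit Defensive.

Import GRing.Theory.
Local Open Scope ring_scope.
Local Open Scope quotient_scope.

Section GeneratedIdeal.
Variables (R : nzRingType) (w : R).

Definition ideal_genP (u : R) : Prop :=
  exists s : seq (R * R), u = \sum_(p <- s) p.1 * w * p.2.
Definition ideal_gen (u : R) : bool := `[< ideal_genP u >].

Lemma ideal_genE u : reflect (ideal_genP u) (ideal_gen u).
Proof. exact: asboolP. Qed.

Lemma ideal_gen_zmod_closed : zmod_closed ideal_gen.
Proof.
split=> [|u v]; first by apply/ideal_genE; exists [::]; rewrite big_nil.
move=> /ideal_genE[s ->] /ideal_genE[t ->]; apply/ideal_genE.
exists (s ++ [seq (- p.1, p.2) | p <- t]); rewrite big_cat big_map /=.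
by congr (_ + _); rewrite -sumrN; apply: eq_bigr => p _; rewrite !mulNr.
Qed.

Lemma ideal_genMl a u : ideal_gen u -> ideal_gen (a * u).
Proof.
move=> /ideal_genE[s ->]; apply/ideal_genE.
exists [seq (a * p.1, p.2) | p <- s]; rewrite big_map /= mulr_sumr.
by apply: eq_bigr => p _; rewrite !mulrA.
Qed.

Lemma ideal_genMr a u : ideal_gen u -> ideal_gen (u * a).
Proof.
move=> /ideal_genE[s ->]; apply/ideal_genE.
exists [seq (p.1, p.2 * a) | p <- s]; rewrite big_map /= mulr_suml.
by apply: eq_bigr => p _; rewrite !mulrA.
Qed.

Lemma ideal_gen_mem : ideal_gen w.
Proof. by apply/ideal_genE; exists [:: (1, 1)]; rewrite big_seq1 mul1r mulr1. Qed.

HB.instance Definition _ :=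
  GRing.isZmodClosed.Build R ideal_gen ideal_gen_zmod_closed.

Definition ideal_gen_zmod : zmodClosed R :=
  GRing.ZmodClosed.clone R ideal_gen _.

End GeneratedIdeal.

(* An action on V annihilated by w detects that the ideal is proper. *)
Lemma ideal_gen_proper (R : nzRingType) (w : R) (V : zmodType)
    (act : R -> V -> V)
    (actD : forall a b v, act (a + b) v = act a v + act b v)
    (actM : forall a b v, act (a * b) v = act a (act b v))
    (act1 : forall v, act 1 v = v) (actw : forall v, act w v = 0) (v : V) :
  v != 0 -> ~~ ideal_gen w 1.
Proof.
move=> /eqP v0; apply/ideal_genE => -[s e1]; apply: v0.
have act0 u : act 0 u = 0 by apply: (addrI (act 0 u)); rewrite -actD !addr0.
have actr0 a : act a 0 = 0 by rewrite -(act0 0) -actM mulr0.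
rewrite -[LHS]act1 e1 (big_morph (act^~ v) (fun a b => actD a b v) (act0 v)).
by rewrite big1 // => p _; rewrite !actM actw actr0.
Qed.

Lemma comm_rel_act (R : nzRingType) (V : zmodType) (act : R -> V -> V)
    (actB : forall a b v, act (a - b) v = act a v - act b v)
    (actM : forall a b v, act (a * b) v = act a (act b v))
    (act1 : forall v, act 1 v = v) (x y : R) (v : V) :
  act x (act y v) - act y (act x v) = v -> act (x * y - y * x - 1) v = 0.
Proof. by move=> e; rewrite !actB !actM act1 e subrr. Qed.

(* The quotient algebra F/(w); w must generate a proper ideal because algebras
   in the hierarchy are nontrivial rings. *)
Section QuotientAlgebra.
Variables (k : fieldType) (F : algType k) (w : F).
Hypothesis proper_w : ~~ ideal_gen w 1.

Definition quot_alg of ~~ ideal_gen w 1 : Type :=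
  Quotient.quot (ideal_gen_zmod w).
Local Notation Q := (quot_alg proper_w).

HB.instance Definition _ := GRing.Zmodule.on Q.

Definition qpi (u : F) : Q := \pi_(Quotient.quot (ideal_gen_zmod w)) u.
Definition qrepr (a : Q) : F := repr (a : Quotient.quot (ideal_gen_zmod w)).

Lemma qpiP u v : reflect (qpi u = qpi v) (ideal_gen w (u - v)).
Proof.
have -> : ideal_gen w (u - v) = (u - v \in ideal_gen_zmod w) by [].
by rewrite Quotient.idealrBE; apply: eqP.
Qed.

Lemma qreprK (a : Q) : qpi (qrepr a) = a.
Proof. exact: reprK. Qed.

Lemma qpiD u v : qpi (u + v) = qpi u + qpi v.
Proof. exact: (Quotient.pi_add (ideal_gen_zmod w) u v). Qed.

Definition qone : Q := qpi 1.
Definition qmul (a b : Q) : Q := qpi (qrepr a * qrepr b).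
Definition qscale (c : k) (a : Q) : Q := qpi (c *: qrepr a).

Lemma qpi_mul u v : qpi (u * v) = qmul (qpi u) (qpi v).
Proof.
apply/qpiP; set u' := qrepr _; set v' := qrepr _.
have uI : ideal_gen w (u - u') by apply/qpiP; rewrite qreprK.
have vI : ideal_gen w (v - v') by apply/qpiP; rewrite qreprK.
have -> : u * v - u' * v' = (u - u') * v + u' * (v - v').
  by rewrite mulrBl mulrBr addrA subrK.
apply: (rpredD (S := ideal_gen_zmod w)); first exact: ideal_genMr.
exact: ideal_genMl.
Qed.

Lemma qpi_scale c u : qpi (c *: u) = qscale c (qpi u).
Proof.
apply/qpiP; rewrite -scalerBr -mulr_algl ideal_genMl //.
by apply/qpiP; rewrite qreprK.
Qed.

Lemma qmulA : associative qmul.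
Proof.
move=> a b c; rewrite -[a]qreprK -[b]qreprK -[c]qreprK.
by rewrite -!qpi_mul mulrA.
Qed.

Lemma qmul1l : left_id qone qmul.
Proof. by move=> a; rewrite -[a]qreprK -qpi_mul mul1r. Qed.

Lemma qmul1r : right_id qone qmul.
Proof. by move=> a; rewrite -[a]qreprK -qpi_mul mulr1. Qed.

Lemma qmulDl : left_distributive qmul +%R.
Proof.
move=> a b c; rewrite -[a]qreprK -[b]qreprK -[c]qreprK.
by rewrite -qpiD -!qpi_mul mulrDl qpiD.
Qed.

Lemma qmulDr : right_distributive qmul +%R.
Proof.
move=> a b c; rewrite -[a]qreprK -[b]qreprK -[c]qreprK.
by rewrite -qpiD -!qpi_mul mulrDr qpiD.
Qed.

Lemma qpi0 : qpi 0 = 0.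
Proof. by apply: (addrI (qpi 0)); rewrite -qpiD !addr0. Qed.

Lemma qone_neq0 : qone != 0.
Proof.
by rewrite -qpi0; apply/eqP => /qpiP; rewrite subr0; apply/negP.
Qed.

HB.instance Definition _ := GRing.Zmodule_isNzRing.Build Q
  qmulA qmul1l qmul1r qmulDl qmulDr qone_neq0.

Lemma qscaleA c d a : qscale c (qscale d a) = qscale (c * d) a.
Proof. by rewrite -[a]qreprK -!qpi_scale scalerA. Qed.

Lemma qscale1 : left_id 1 qscale.
Proof. by move=> a; rewrite -[a]qreprK -qpi_scale scale1r. Qed.

Lemma qscaleDr : right_distributive qscale +%R.
Proof.
move=> c a b; rewrite -[a]qreprK -[b]qreprK.
by rewrite -qpiD -!qpi_scale scalerDr qpiD.
Qed.

Lemma qscaleDl a : {morph qscale^~ a : c d / c + d}.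
Proof. by move=> c d; rewrite -[a]qreprK -!qpi_scale scalerDl qpiD. Qed.

HB.instance Definition _ := GRing.Zmodule_isLmodule.Build k Q
  qscaleA qscale1 qscaleDr qscaleDl.

Lemma qpiM u v : qpi (u * v) = qpi u * qpi v.
Proof. exact: qpi_mul. Qed.

Lemma qpiZ c u : qpi (c *: u) = c *: qpi u.
Proof. exact: qpi_scale. Qed.

Lemma qpi1 : qpi 1 = 1.
Proof. by []. Qed.

Lemma qscaleAl (c : k) (a b : Q) : c *: (a * b) = (c *: a) * b.
Proof.
by rewrite -[a]qreprK -[b]qreprK -qpiM -!qpiZ -qpiM scalerAl.
Qed.

HB.instance Definition _ := GRing.Lmodule_isLalgebra.Build k Q qscaleAl.

Lemma qscaleAr (c : k) (a b : Q) : c *: (a * b) = a * (c *: b).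
Proof.
by rewrite -[a]qreprK -[b]qreprK -qpiM -!qpiZ -qpiM scalerAr.
Qed.

HB.instance Definition _ := GRing.Lalgebra_isAlgebra.Build k Q qscaleAr.

End QuotientAlgebra.

Section WeylAlgebra.
Variable k : fieldType.

Lemma malg_scaleAr (c : k) (u v : {malg k[{fmonom bool}]}) :
  c *: (u * v) = u * (c *: v).
Proof.
apply/malgP => m; rewrite (mcoeffMlw _ (fsubset_refl _) (msuppZ_le c v)).
rewrite mcoeffZ mcoeffMl mulr_sumr.
apply: eq_bigr => m1 _; rewrite mulr_sumr; apply: eq_bigr => m2 _.
by rewrite mcoeffZ mulrnAr mulrCA.
Qed.

(* The free algebra k<x,y>: the monoid algebra of the free monoid on two
   letters, [false] standing for x and [true] for y. *)
Definition free2 : algType k := HB.pack {malg k[{fmonom bool}]}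
  (GRing.Lalgebra_isAlgebra.Build k {malg k[{fmonom bool}]} malg_scaleAr).

Definition free_x : free2 := (<< fmu false >> : {malg k[{fmonom bool}]}).
Definition free_y : free2 := (<< fmu true >> : {malg k[{fmonom bool}]}).
Definition weyl_rel : free2 := free_x * free_y - free_y * free_x - 1.

(* The action of k<x,y> on k[X] with x = d/dX and y = X; it shows that the
   ideal (xy - yx - 1) is proper. *)
Definition word_act (w : seq bool) (p : {poly k}) : {poly k} :=
  foldr (fun b q => if b then 'X * q else q^`()) p w.

Lemma word_act_linear w : linear (word_act w).
Proof.
elim: w => [|b w IH] // c p q.
have E r : word_act (b :: w) r =
  if b then 'X * word_act w r else (word_act w r)^`() by [].
rewrite !E (IH c p q); case: (b); first by rewrite mulrDr scalerAr.
by rewrite derivD derivZ.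
Qed.

Lemma word_actZ w c p : word_act w (c *: p) = c *: word_act w p.
Proof.
have := word_act_linear w c p 0; rewrite addr0 => ->.
suff -> : word_act w 0 = 0 by rewrite addr0.
by have := word_act_linear w (-1) 0 0; rewrite scaleN1r oppr0 addr0 => ->;
  rewrite scaleN1r addNr.
Qed.

Lemma word_actD w p q : word_act w (p + q) = word_act w p + word_act w q.
Proof. by have := word_act_linear w 1 p q; rewrite !scale1r. Qed.

Definition free_act (u : {malg k[{fmonom bool}]}) (p : {poly k}) : {poly k} :=
  \sum_(m <- msupp u) u@_m *: word_act m p.

Lemma free_actEw (d : {fset {fmonom bool}}) u p : (msupp u `<=` d)%fset ->
  free_act u p = \sum_(m <- d) u@_m *: word_act m p.
Proof.
move=> le; rewrite /free_act (big_fset_incl _ le) //= => m _ /mcoeff_outdom ->.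
by rewrite scale0r.
Qed.

Lemma free_actU c m p : free_act << c *g m >> p = c *: word_act m p.
Proof. by rewrite (free_actEw _ msuppU_le) big_seq_fset1 mcoeffUU. Qed.

Lemma free_actD u v p : free_act (u + v) p = free_act u p + free_act v p.
Proof.
rewrite (free_actEw _ (msuppD_le u v)).
rewrite (free_actEw _ (fsubsetUl (msupp u) (msupp v))).
rewrite (free_actEw _ (fsubsetUr (msupp u) (msupp v))) -big_split /=.
by apply: eq_bigr => m _; rewrite mcoeffD scalerDl.
Qed.

Lemma free_act0l p : free_act 0 p = 0.
Proof. by rewrite /free_act msupp0 big_seq_fset0. Qed.

Lemma free_actB u v p : free_act (u - v) p = free_act u p - free_act v p.
Proof. by apply/eqP; rewrite eq_sym subr_eq -free_actD subrK. Qed.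

Lemma free_act_sum (I : Type) (s : seq I) (F : I -> {malg k[{fmonom bool}]}) p :
  free_act (\sum_(i <- s) F i) p = \sum_(i <- s) free_act (F i) p.
Proof.
exact: (big_morph (free_act^~ p) (fun u v => free_actD u v p) (free_act0l p)).
Qed.

Lemma word_act0 w : word_act w 0 = 0.
Proof. by rewrite -[in LHS](scale0r 0) word_actZ scale0r. Qed.

Lemma word_act_sum w (I : Type) (s : seq I) (F : I -> {poly k}) :
  word_act w (\sum_(i <- s) F i) = \sum_(i <- s) word_act w (F i).
Proof. exact: (big_morph _ (word_actD w) (word_act0 w)). Qed.

Lemma free_actM u v p : free_act (u * v) p = free_act u (free_act v p).
Proof.
rewrite malgME free_act_sum; apply: eq_bigr => m _.
rewrite free_act_sum word_act_sum scaler_sumr; apply: eq_bigr => n _.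
rewrite free_actU word_actZ scalerA; congr (_ *: _).
by rewrite fmM /word_act foldr_cat.
Qed.

Lemma free_act1 p : free_act 1 p = p.
Proof. by rewrite free_actU scale1r fm1. Qed.

Definition free2_act (u : free2) (p : {poly k}) : {poly k} := free_act u p.

Lemma free2_actD u v p : free2_act (u + v) p = free2_act u p + free2_act v p.
Proof. exact: free_actD. Qed.

Lemma free2_actB u v p : free2_act (u - v) p = free2_act u p - free2_act v p.
Proof. exact: free_actB. Qed.

Lemma free2_actM u v p : free2_act (u * v) p = free2_act u (free2_act v p).
Proof. exact: free_actM. Qed.

Lemma free2_act1 p : free2_act 1 p = p.
Proof. exact: free_act1. Qed.

Lemma free2_act_x p : free2_act free_x p = p^`().
Proof. by rewrite /free2_act /free_x free_actU scale1r fmU. Qed.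

Lemma free2_act_y p : free2_act free_y p = 'X * p.
Proof. by rewrite /free2_act /free_y free_actU scale1r fmU. Qed.

Lemma weyl_rel_proper : ~~ ideal_gen weyl_rel 1.
Proof.
have act_rel p : free2_act weyl_rel p = 0.
  apply: (comm_rel_act free2_actB free2_actM free2_act1).
  rewrite !(free2_act_x, free2_act_y).
  by rewrite derivM derivX mul1r addrK.
have nz : (1 : {poly k}) != 0 := oner_neq0 _.
exact: (ideal_gen_proper free2_actD free2_actM free2_act1 act_rel nz).
Qed.

(* The first Weyl algebra A_1(k) = k<x,y>/(xy - yx - 1). *)
Definition weyl : algType k := quot_alg weyl_rel_proper.

Definition weyl_x : weyl := qpi weyl_rel_proper free_x.
Definition weyl_y : weyl := qpi weyl_rel_proper free_y.

Lemma weyl_commutation : weyl_x * weyl_y - weyl_y * weyl_x = 1.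
Proof.
apply: (canLR (addrK _)); rewrite -!qpiM -qpi1 -qpiD; apply/qpiP.
by rewrite opprD addrA addrAC -/weyl_rel ideal_gen_mem.
Qed.

End WeylAlgebra.

Section ModuleNotions.
Variables (R : nzRingType) (M : lmodType R).

Definition finitely_generated : Prop :=
  exists (n : nat) (e : 'I_n -> M),
    forall m : M, exists a : 'I_n -> R, m = \sum_(i < n) a i *: e i.

Definition torsion_free : Prop :=
  forall (a : R) (m : M), a *: m = 0 -> a = 0 \/ m = 0.

Definition lin_indep (n : nat) (e : 'I_n -> M) : Prop :=
  forall a : 'I_n -> R, \sum_(i < n) a i *: e i = 0 -> forall i, a i = 0.

(* The rank of a module over an Ore domain R, i.e. the dimension of its
   extension of scalars to the division ring of fractions of R: the maximal
   number of R-linearly independent elements. *)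
Definition has_rank (n : nat) : Prop :=
  (exists e : 'I_n -> M, lin_indep e) /\
  (forall e : 'I_n.+1 -> M, ~ lin_indep e).

End ModuleNotions.

(* Unital two-term right A_infinity-modules K = K0 + K1 (degrees 0 and 1) over
   a k-algebra A.  A map out of a tensor product is given as a multilinear
   map. *)
Record ainf_module (k : fieldType) (A : algType k) := AInfModule {
  K0 : lmodType k;
  K1 : lmodType k;
  m1 : {linear K0 -> K1};
  m2_0 : K0 -> A -> K0;
  m2_1 : K1 -> A -> K1;
  m3 : K1 -> A -> A -> K0;
  m2_0_linl : forall a, linear (m2_0^~ a);
  m2_0_linr : forall u, linear (m2_0 u);
  m2_1_linl : forall a, linear (m2_1^~ a);
  m2_1_linr : forall v, linear (m2_1 v);
  m3_lin1 : forall a b, linear (fun v => m3 v a b);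
  m3_lin2 : forall v b, linear (fun a => m3 v a b);
  m3_lin3 : forall v a, linear (m3 v a);
  ainf_m1m2 : forall u a, m1 (m2_0 u a) = m2_1 (m1 u) a;
  ainf_m2m2_0 : forall u a b,
    m2_0 (m2_0 u a) b - m2_0 u (a * b) = m3 (m1 u) a b;
  ainf_m2m2_1 : forall v a b,
    m2_1 (m2_1 v a) b - m2_1 v (a * b) = m1 (m3 v a b);
  ainf_m2m3 : forall v a b c,
    - m3 v (a * b) c + m3 v a (b * c) + m3 (m2_1 v a) b c
      - m2_0 (m3 v a b) c = 0;
  m2_0_unit : forall u, m2_0 u 1 = u;
  m2_1_unit : forall v, m2_1 v 1 = v;
  m3_unit1 : forall v a, m3 v 1 a = 0;
  m3_unit2 : forall v a, m3 v a 1 = 0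
}.

Section Envelopes.
Variables (k : fieldType) (A : algType k).

(* Right A-modules are left modules over the converse ring A^c: the right
   action m.a is (a : A^c) *: m.  A scalar c : k acts on them as c%:A.
   Since M sits in degree 0, a morphism r from M to K has no higher components
   (degree reasons), and being a quasi-isomorphism means that r is a bijection
   onto H^0(K) = ker m1 and that H^1(K) = coker m1 vanishes. *)
Record quasi_iso (M : lmodType A^c) (K : ainf_module A) (r : M -> K0 K) :
    Prop := QuasiIso {
  quasi_iso_linear : forall (c : k) (m n : M),
    r ((c%:A : A^c) *: m + n) = c *: r m + r n;
  quasi_iso_m1 : forall m, m1 K (r m) = 0;
  quasi_iso_m2 : forall (m : M) (a : A), r ((a : A^c) *: m) = m2_0 (r m) a;
  quasi_iso_H0_inj : injective r;
  quasi_iso_H0_surj : forall u : K0 K, m1 K u = 0 -> exists m, r m = u;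
  quasi_iso_H1 : forall v : K1 K, exists u, m1 K u = v
}.

(* [bijective (m2_0 i)] says that A -> K0, a |-> m2_0(i, a), is an isomorphism of
   vector spaces, since it is linear by [m2_0_linr]. *)
Definition envelope_axioms (x y : A) (K : ainf_module A) : Prop :=
  finitely_generated (K1 K) /\
  exists i : K0 K,
    [/\ bijective (m2_0 i),
        forall (a : A) (v : K1 K), m3 v x a = 0,
        forall (a : A) (v : K1 K), m3 v a y = 0
      & forall v : K1 K, exists c : k, m3 v y x = c *: i].

Definition is_envelope (x y : A) (M : lmodType A^c) (K : ainf_module A)
    (r : M -> K0 K) : Prop :=
  envelope_axioms x y K /\ quasi_iso r.

End Envelopes.

(* Main.v *)
Require Import Defs.
From HB Require Import structures.
From mathcomp Require Import all_boot all_algebra.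
From mathcomp Require Import generic_quotient ring_quotient boolp.
From mathcomp Require Import finmap monalg.
From mathcomp Require Import zify.

(** The envelope is a deformation of the free module: K0 is the algebra A
    itself with i = 1, on which y acts by right multiplication while x acts by
    right multiplication corrected by polynomials in y.

    Suppose K0 carries a bilinear unital product [act u a] by elements of A,
    not necessarily associative, and contains a copy of M as a subspace that is
    stable and on which the product is the module structure.  Then K1 = K0/M
    and m3 = the associator of the product form a two-term A-infinity module:
    the associator vanishes on M, so it descends to K1, and all the identities
    hold for trivial reasons.  So it is enough to extend the operators x and y
    from M to a larger space, with finite-dimensional quotient, in such a way
    that the commutation relation fails only by multiples of i and that the
    elements obtained from i by applying x^p y^q form a basis.

    Step 1 ([embeds_with_polynomial]).  As A is an Ore domain, a finitely
    generated torsion-free M of rank one embeds in A, and dividing on the left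
    by an element of M of least y-degree replaces the image by a right ideal
    that contains a nonzero polynomial h(x).

    Step 2 ([polypart_embedding]).  The leading coefficients in y of the
    elements of that ideal form an ideal g k[x].  Dividing all the coefficients
    by g and dropping the remainders gives a linear injection r : M -> A with
    finite-dimensional cokernel.  It commutes with y, and commutes with x up to
    a polynomial in y: r(m x) = r(m) x + rho(m)(y).

    Step 3 ([defect_extension]).  The k[y]-linear map rho from r(M) to k[y]
    extends uniquely to a k[y]-linear map from A to k(y), because A/r(M) is
    killed by some nonzero q(y).  Its polynomial part xi : A -> k[y] is
    rho(u q) divided by q; truncation makes it k[y]-linear only up to
    constants.  With X u = u x + xi(u)(y) the commutator relation then holds up
    to k.1, and exactly on r(M).

    Step 4 ([act1_bij], [act_morph]).  Let x^i y^j act by X^i followed by right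
    multiplication by y^j.  As X differs from right multiplication by x by
    terms of x-degree zero, acting on 1 is unitriangular for the x-degree, hence
    bijective; and r is a morphism from M. *)

Set Implicit Arguments.
Unset Strict Implicit.
Unset Printing Implicit Defensive.

Import GRing.Theory.
Local Open Scope ring_scope.

Lemma deriv_eq0_size (R : idomainType) (p : {poly R}) :
  [pchar R] =i pred0 -> p^`() = 0 -> (size p <= 1)%N.
Proof.
move=> char0 dp0; apply/leq_sizeP => -[//|j] _.
have /eqP := congr1 (fun q : {poly R} => q`_j) dp0.
rewrite coef_deriv coef0 -mulr_natr mulf_eq0 => /orP[/eqP //|].
by rewrite ((pcharf0P R).1 char0).
Qed.

(** Multiplication by X commutes with taking quotients by g up to a constant,
    since X times a remainder has degree at most that of g.  For division in x this
    keeps the defect of x-linearity inside k[y]; for division in y it keeps the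
    failure of the commutation relation inside k.1. *)
Lemma size_divp_mulX (k : fieldType) (g f : {poly k}) : g != 0 ->
  (size (('X * f) %/ g - 'X * (f %/ g))%R <= 1)%N.
Proof.
move=> nz_g; rewrite {1}(divp_eq f g) mulrDr mulrA divpD mulpK // addrC addKr.
rewrite size_divp // leq_subLR addn1 prednK ?size_poly_gt0 //.
apply: leq_trans (size_polyMleq _ _) _; rewrite size_polyX.
exact: ltn_modpN0.
Qed.

(** * Quotients of vector spaces *)

Section QuotientSpace.

Variables (k : fieldType) (V : lmodType k) (N : V -> Prop).
Hypothesis N0 : N 0.
Hypothesis N_lin : forall (c : k) u v, N u -> N v -> N (c *: u + v).

Definition subspace_pred (u : V) : bool := `[< N u >].

Lemma subspace_zmod_closed : zmod_closed subspace_pred.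
Proof.
split=> [|u v /asboolP Nu /asboolP Nv]; apply/asboolP => //.
by rewrite addrC -scaleN1r; apply: N_lin.
Qed.
HB.instance Definition _ :=
  GRing.isZmodClosed.Build V subspace_pred subspace_zmod_closed.

Definition quotient_space : Type :=
  Quotient.quot (GRing.ZmodClosed.clone V subspace_pred _).
HB.instance Definition _ := GRing.Zmodule.on quotient_space.

Definition qproj (u : V) : quotient_space :=
  (\pi_(Quotient.quot (GRing.ZmodClosed.clone V subspace_pred _)) u)%qT.
Definition qrep (a : quotient_space) : V :=
  repr (a : Quotient.quot (GRing.ZmodClosed.clone V subspace_pred _)).

Lemma qrepK a : qproj (qrep a) = a.
Proof. exact: reprK. Qed.

Lemma qprojP u v : qproj u = qproj v <-> N (u - v).
Proof.
split.
  move/eqP; rewrite -Quotient.idealrBE => h; exact/asboolP.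
move=> h; apply/eqP; rewrite -Quotient.idealrBE; exact/asboolP.
Qed.

Lemma qprojD u v : qproj (u + v) = qproj u + qproj v.
Proof. exact: (Quotient.pi_add (GRing.ZmodClosed.clone V subspace_pred _) u v). Qed.

Definition quotient_scale (c : k) (a : quotient_space) := qproj (c *: qrep a).

Lemma qprojZ_subproof c u : qproj (c *: u) = quotient_scale c (qproj u).
Proof.
apply/qprojP; rewrite -scalerBr -[_ *: _]addr0; apply: N_lin => //.
by apply/qprojP; rewrite qrepK.
Qed.

Lemma quotient_scaleA c d a :
  quotient_scale c (quotient_scale d a) = quotient_scale (c * d) a.
Proof. by rewrite -[a]qrepK -!qprojZ_subproof scalerA. Qed.
Lemma quotient_scale1 : left_id 1 quotient_scale.
Proof. by move=> a; rewrite -[a]qrepK -qprojZ_subproof scale1r. Qed.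
Lemma quotient_scaleDr : right_distributive quotient_scale +%R.
Proof.
move=> c a b; rewrite -[a]qrepK -[b]qrepK.
by rewrite -qprojD -!qprojZ_subproof scalerDr qprojD.
Qed.
Lemma quotient_scaleDl a : {morph quotient_scale^~ a : c d / c + d}.
Proof. by move=> c d; rewrite -[a]qrepK -!qprojZ_subproof scalerDl qprojD. Qed.
HB.instance Definition _ := GRing.Zmodule_isLmodule.Build k quotient_space
  quotient_scaleA quotient_scale1 quotient_scaleDr quotient_scaleDl.

Lemma qproj_linear : linear qproj.
Proof. by move=> c u v; rewrite qprojD qprojZ_subproof. Qed.
HB.instance Definition _ :=
  GRing.isLinear.Build k V quotient_space _ qproj qproj_linear.

Lemma qproj_eq0 u : qproj u = 0 <-> N u.
Proof. by rewrite -(raddf0 qproj) qprojP subr0. Qed.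

End QuotientSpace.

(** * Two-term modules from associators *)

Section AssociatorModule.

Variables (k : fieldType) (A : algType k) (V : lmodType k).
Variables (act : V -> A -> V) (N : V -> Prop).
Hypothesis act_linl : forall a, linear (act^~ a).
Hypothesis act_linr : forall u, linear (act u).
Hypothesis act1 : forall u, act u 1 = u.
Hypothesis N0 : N 0.
Hypothesis N_lin : forall (c : k) u v, N u -> N v -> N (c *: u + v).
Hypothesis N_act : forall u a, N u -> N (act u a).
Hypothesis N_assoc : forall u a b, N u -> act (act u a) b = act u (a * b).

Local Notation Q := (quotient_space N0 N_lin).
Local Notation proj := (qproj N0 N_lin).

Definition associator u a b := act (act u a) b - act u (a * b).

Lemma actBl u v a : act (u - v) a = act u a - act v a.
Proof. by rewrite [u - v]addrC -scaleN1r (act_linl a) /= scaleN1r addrC. Qed.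

Lemma associator_lin a b : linear (fun u => associator u a b).
Proof.
move=> c u v; rewrite /associator /=.
rewrite (act_linl a) (act_linl b) (act_linl (a * b)) /=.
by rewrite scalerBr opprD addrACA.
Qed.

Lemma associator_eq u v a b : N (u - v) -> associator u a b = associator v a b.
Proof.
move=> Nuv; apply/eqP; rewrite -subr_eq0; apply/eqP.
have /= := associator_lin a b (-1) v u; rewrite !scaleN1r [- v + u]addrC.
rewrite [- associator _ _ _ + _]addrC => <-.
by rewrite /associator N_assoc ?subrr.
Qed.

Definition qact (v : Q) a : Q := proj (act (qrep v) a).
Definition qassociator (v : Q) a b : V := associator (qrep v) a b.

Lemma qrep_proj u : N (qrep (proj u) - u).
Proof. by apply/(qprojP N0 N_lin); rewrite qrepK. Qed.

Lemma qactE u a : qact (proj u) a = proj (act u a).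
Proof. by apply/(qprojP N0 N_lin); rewrite -actBl; apply/N_act/qrep_proj. Qed.

Lemma qassociatorE u a b : qassociator (proj u) a b = associator u a b.
Proof. exact/associator_eq/qrep_proj. Qed.

Lemma qact_linl a : linear (qact^~ a).
Proof.
move=> c v w; rewrite -[v]qrepK -[w]qrepK -linearP !qactE act_linl.
by rewrite linearP.
Qed.

Lemma qact_linr v : linear (qact v).
Proof. by move=> c a b; rewrite /qact act_linr linearP. Qed.

Lemma qassociator_lin1 a b : linear (fun v => qassociator v a b).
Proof.
move=> c v w; rewrite -[v]qrepK -[w]qrepK -linearP !qassociatorE.
exact: associator_lin.
Qed.

Lemma qassociator_lin2 v b : linear (fun a => qassociator v a b).
Proof.
move=> c a a'; rewrite /qassociator /associator act_linr act_linl.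
by rewrite mulrDl -scalerAl act_linr scalerBr opprD addrACA.
Qed.

Lemma qassociator_lin3 v a : linear (qassociator v a).
Proof.
move=> c b b'; rewrite /qassociator /associator act_linr.
by rewrite mulrDr -scalerAr act_linr scalerBr opprD addrACA.
Qed.

Lemma qact_assoc v a b :
  qact (qact v a) b - qact v (a * b) = proj (qassociator v a b).
Proof. by rewrite -[v]qrepK qassociatorE !qactE linearB. Qed.

Lemma qassociator_cocycle v a b c :
  - qassociator v (a * b) c + qassociator v a (b * c) + qassociator (qact v a) b c
  - act (qassociator v a b) c = 0.
Proof.
rewrite -[v]qrepK; move: (qrep v) => u.
rewrite qactE !qassociatorE /associator actBl !mulrA.
by rewrite opprB [_ - _ + _]addrC subrKA [_ - _ + _]addrC subrKA subrr.
Qed.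

Lemma qact_unit v : qact v 1 = v.
Proof. by rewrite /qact act1 qrepK. Qed.

Lemma qassociator_unit1 v a : qassociator v 1 a = 0.
Proof. by rewrite /qassociator /associator act1 mul1r subrr. Qed.

Lemma qassociator_unit2 v a : qassociator v a 1 = 0.
Proof. by rewrite /qassociator /associator act1 mulr1 subrr. Qed.

(** Every identity of the structure is an identity between iterated products,
    except that the associator has to be computed on representatives of classes
    modulo N; this is harmless as it vanishes on N. *)
Definition associator_module : ainf_module A :=
  @AInfModule k A V Q proj act qact qassociator act_linl act_linr
    qact_linl qact_linr qassociator_lin1 qassociator_lin2 qassociator_lin3
    (fun u a => esym (qactE u a)) (fun u a b => esym (qassociatorE u a b))
    qact_assoc qassociator_cocycle act1
    qact_unit qassociator_unit1 qassociator_unit2.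

End AssociatorModule.

(** * Common multiples from division with remainder *)

(** Euclid's algorithm, run on the pair (a, b) with remainders b g - a c: the
    pseudo-divisor g only has to be nonzero, and the equation a b' = b a' for a
    remainder lifts back to one for the original pair. *)
Lemma ore_of_pdiv (R : nzRingType) (dg : R -> nat)
    (dom : forall a b : R, a * b = 0 -> a = 0 \/ b = 0)
    (pdiv : forall a b : R, a != 0 -> b != 0 -> (dg a <= dg b)%N ->
      exists g c, g != 0 /\ (dg (b * g - a * c)%R < dg b)%N) :
  forall a b : R, b != 0 -> exists b' a', b' != 0 /\ a * b' = b * a'.
Proof.
have domN (a b : R) : a != 0 -> b != 0 -> a * b != 0.
  by move=> /negPf a0 /negPf b0; apply/eqP => /dom[] /eqP; rewrite ?a0 ?b0.
move=> a b; have [n] := ubnP (dg a + dg b)%N.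
elim: n a b => // n IH a b; rewrite ltnS => len nz_b.
have [->|nz_a] := eqVneq a 0.
  by exists 1, 0; rewrite oner_neq0 mul0r mulr0.
case: (leqP (dg b) (dg a)) => [leba|/ltnW leab].
  have [g [c [nz_g lt_r]]] := pdiv b a nz_b nz_a leba.
  have [|//|b' [a' [nz_b' e]]] := IH (a * g - b * c) b.
    by apply: leq_trans len; rewrite ltn_add2r.
  exists (g * b'), (a' + c * b'); split; first exact: domN.
  by rewrite mulrDr -e mulrBl !mulrA subrK.
have [g [c [nz_g lt_r]]] := pdiv a b nz_a nz_b leab.
have [/eqP|nz_r] := eqVneq (b * g - a * c) 0.
  rewrite subr_eq0 => /eqP e; exists c, g; split => //.
  by apply: contra_neq (domN _ _ nz_b nz_g) => c0; rewrite e c0 mulr0.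
have [||b' [a' [nz_b' e]]] := IH a (b * g - a * c) => //.
  by apply: leq_trans len; rewrite ltn_add2l.
have e' : a * (b' + c * a') = b * (g * a') by rewrite mulrDr e mulrBl !mulrA subrK.
exists (b' + c * a'), (g * a'); split => //.
apply/eqP => z; move: e' e; rewrite z mulr0 => /esym/dom[/eqP|/dom[/eqP|->]].
- by rewrite (negPf nz_b).
- by rewrite (negPf nz_g).
by rewrite mulr0 => /dom[] /eqP; [rewrite (negPf nz_a) | rewrite (negPf nz_b')].
Qed.

(** * Normal form in the Weyl algebra *)

Section WeylEnvelope.

(* Only the relation and the generation of A by x and y are used from here on,
   so that the quotient construction of the Weyl algebra stays hidden. *)
Variables (k : fieldType) (A : algType k) (x y : A).
Hypothesis char0 : [pchar k] =i pred0.
Hypothesis comm_xy : x * y - y * x = 1.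

Local Notation kX := {poly k}.
Local Notation kXY := {poly {poly k}}.

Local Notation ev := (@horner_alg k A).

Lemma evX t : ev t 'X = t.
Proof. exact: horner_algX. Qed.
Lemma evC t (c : k) : ev t c%:P = c%:A.
Proof. exact: horner_algC. Qed.
Lemma evZ t c f : ev t (c *: f) = c *: ev t f.
Proof. by rewrite -mul_polyC rmorphM /= evC mulr_algl. Qed.

(** The sum of the u_j(x) y^j: the outer variable is y, and powers of x stand to
    the left of powers of y. *)
Definition xyval (u : kXY) : A := (map_poly (ev x) u).[y].

Lemma xyval_is_zmod_morphism : zmod_morphism xyval.
Proof. by move=> u v; rewrite /xyval rmorphB hornerD hornerN. Qed.
HB.instance Definition _ :=
  GRing.isZmodMorphism.Build kXY A xyval xyval_is_zmod_morphism.

Lemma xyvalC f : xyval f%:P = ev x f.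
Proof. by rewrite /xyval map_polyC hornerC. Qed.
Lemma xyvalMX u : xyval (u * 'X) = xyval u * y.
Proof. by rewrite /xyval rmorphM /= map_polyX hornerMX. Qed.
Lemma xyvalMC f u : xyval (f%:P * u) = ev x f * xyval u.
Proof. by rewrite /xyval rmorphM /= map_polyC hornerCM. Qed.
Lemma xyval1 : xyval 1 = 1.
Proof. by rewrite xyvalC rmorph1. Qed.

Lemma ev_commute t f : t * ev t f = ev t f * t.
Proof. by rewrite -{1 4}[t](evX t) -!rmorphM mulrC. Qed.

Lemma mulyx : y * x = x * y - 1.
Proof. by rewrite -comm_xy opprB addrCA subrr addr0. Qed.

Lemma xyval_mulx u : xyval u * x = xyval ('X%:P * u - u^`()).
Proof.
elim/poly_ind: u => [|u f IH]; first by rewrite mulr0 deriv0 subr0 raddf0 mul0r.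
have -> : 'X%:P * (u * 'X + f%:P) - (u * 'X + f%:P)^`()
    = ('X%:P * u - u^`()) * 'X - u + ('X%:P * f%:P) :> kXY.
  rewrite derivD derivM derivX derivC mulr1 addr0 mulrDr mulrBl mulrA opprD.
  by rewrite addrACA -!addrA [_ - u]addrC !addrA.
rewrite !raddfD raddfN /= !xyvalMX -IH xyvalMC !xyvalC evX mulrDl ev_commute.
by rewrite -!mulrA mulyx mulrBr mulr1.
Qed.

Lemma ev_muly f : ev x f * y = y * ev x f + ev x f^`().
Proof.
elim/poly_ind: f => [|f c IH]; first by rewrite deriv0 !raddf0 mul0r mulr0 addr0.
rewrite derivD derivM derivX derivC mulr1 addr0 !raddfD /= !rmorphM /= evX evC.
have -> : (ev x f * x + c%:A) * y = ev x f * y * x + ev x f + c *: y.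
  by rewrite mulrDl mulr_algl -!mulrA mulyx mulrBr mulr1 subrK.
have -> : y * (ev x f * x + c%:A) = y * ev x f * x + c *: y.
  by rewrite mulrDr mulr_algr mulrA.
by rewrite IH mulrDl -!addrA; congr (_ + _); rewrite addrCA addrC -addrA addrCA.
Qed.

(** The commutator with y acts on k[x] as the derivative, so in characteristic
    zero a polynomial relation on x can be differentiated down to a nonzero
    constant. *)
Lemma ev_inj : injective (ev x).
Proof.
suff ker n (f : kX) : (size f <= n)%N -> ev x f = 0 -> f = 0.
  move=> f g /eqP; rewrite -subr_eq0 -raddfB => /eqP.
  by move=> /(ker _ _ (leqnn _)) /subr0_eq.
elim: n f => [|n IH] f; first by rewrite size_poly_leq0 => /eqP.
move=> szf f0.
have df0 : f^`() = 0.
  apply: IH; last first.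
    by apply: (addrI (y * ev x f)); rewrite -ev_muly f0 mul0r mulr0 addr0.
  have [->|nz_f] := eqVneq f 0; first by rewrite deriv0 size_poly0.
  by rewrite -ltnS (leq_trans (lt_size_deriv nz_f)).
move/size1_polyC: (deriv_eq0_size char0 df0) f0 => ->.
by rewrite evC => /eqP; rewrite scaler_eq0 oner_eq0 orbF => /eqP ->.
Qed.

(** As for [ev_inj], with the commutator with x, which differentiates in y. *)
Lemma xyval_inj : injective xyval.
Proof.
suff ker n (u : kXY) : (size u <= n)%N -> xyval u = 0 -> u = 0.
  move=> u v /eqP; rewrite -subr_eq0 -raddfB => /eqP.
  by move=> /(ker _ _ (leqnn _)) /subr0_eq.
elim: n u => [|n IH] u; first by rewrite size_poly_leq0 => /eqP.
move=> szu u0.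
have du0 : u^`() = 0.
  apply: IH.
    have [->|nz_u] := eqVneq u 0; first by rewrite deriv0 size_poly0.
    by rewrite -ltnS (leq_trans (lt_size_deriv nz_u)).
  have := xyval_mulx u; rewrite u0 mul0r raddfB /= xyvalMC u0 mulr0 sub0r.
  by move/eqP; rewrite eq_sym oppr_eq0 => /eqP.
(* u is now constant in y, so that it lies in k[x]. *)
have char0X : [pchar kX] =i pred0 by move=> p; rewrite pchar_poly char0.
move/size1_polyC: (deriv_eq0_size char0X du0) u0 => ->.
by rewrite xyvalC -(raddf0 (ev x)) => /ev_inj ->.
Qed.

Hypothesis gen_xy : forall S : A -> Prop, S 1 ->
  (forall c a b, S a -> S b -> S (c *: a + b)) ->
  (forall a, S a -> S (a * x)) -> (forall a, S a -> S (a * y)) ->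
  forall a, S a.

Lemma xyval_surj a : exists u, xyval u = a.
Proof.
elim/gen_xy: a => [|c a b [u <-] [v <-]|a [u <-]|a [u <-]].
- by exists 1; rewrite xyval1.
- exists (c%:P%:P * u + v); rewrite raddfD /= xyvalMC evC.
  by rewrite -scalerAl mul1r.
- by exists ('X%:P * u - u^`()); rewrite xyval_mulx.
- by exists (u * 'X); rewrite xyvalMX.
Qed.

Definition xycoef (a : A) : kXY := projT1 (cid (xyval_surj a)).
Lemma xycoefK : cancel xycoef xyval.
Proof. by move=> a; exact: projT2 (cid (xyval_surj a)). Qed.
Lemma xyvalK : cancel xyval xycoef.
Proof. by move=> u; apply: xyval_inj; rewrite xycoefK. Qed.

Lemma xycoef_is_zmod_morphism : zmod_morphism xycoef.
Proof. by move=> a b; apply: xyval_inj; rewrite raddfB /= !xycoefK. Qed.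
HB.instance Definition _ :=
  GRing.isZmodMorphism.Build A kXY xycoef xycoef_is_zmod_morphism.

Lemma xycoef_ev f : xycoef (ev x f) = f%:P.
Proof. by rewrite -xyvalC xyvalK. Qed.
Lemma xycoef_evM f a : xycoef (ev x f * a) = f%:P * xycoef a.
Proof. by rewrite -{1}[a]xycoefK -xyvalMC xyvalK. Qed.
Lemma xycoef_muly a : xycoef (a * y) = xycoef a * 'X.
Proof. by rewrite -{1}[a]xycoefK -xyvalMX xyvalK. Qed.
Lemma xycoef_mulx a : xycoef (a * x) = 'X%:P * xycoef a - (xycoef a)^`().
Proof. by rewrite -{1}[a]xycoefK xyval_mulx xyvalK. Qed.
Lemma xycoefZ (c : k) a : xycoef (c *: a) = c%:P%:P * xycoef a.
Proof. by rewrite -xycoef_evM evC mulr_algl. Qed.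
Lemma xycoef_eq0 a : (xycoef a == 0) = (a == 0).
Proof. by rewrite -(raddf0 xycoef) (can_eq xycoefK). Qed.

Definition ysize a := size (xycoef a).

Lemma ysize_gt0 a : (0 < ysize a)%N = (a != 0).
Proof. by rewrite /ysize size_poly_gt0 xycoef_eq0. Qed.

Lemma eq_from_xycoef a b : (forall j, (xycoef a)`_j = (xycoef b)`_j) -> a = b.
Proof. by move=> e; apply: (can_inj xycoefK); apply/polyP. Qed.

(** Horner's scheme in y as an induction principle; it replaces sums over
    monomials in most proofs below. *)
Lemma weyl_horner_ind (S : A -> Prop) : S 0 ->
  (forall a f, S a -> S (a * y + ev x f)) -> forall a, S a.
Proof.
move=> S0 Sy a; rewrite -[a]xycoefK; elim/poly_ind: (xycoef a) => [|u f IH].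
  by rewrite raddf0.
by rewrite raddfD /= xyvalMX xyvalC; apply: Sy.
Qed.

Lemma xyval_map_polyC (q : kX) : xyval (map_poly polyC q) = ev y q.
Proof.
elim/poly_ind: q => [|q c IH]; first by rewrite !raddf0.
rewrite !raddfD /= !rmorphM /= map_polyX map_polyC /= xyvalMX IH xyvalC !evC.
by rewrite evX.
Qed.

Lemma xycoef_evy (q : kX) : xycoef (ev y q) = map_poly polyC q.
Proof. by rewrite -xyval_map_polyC xyvalK. Qed.

Lemma ev_y_inj : injective (ev y).
Proof.
move=> p q e; apply/polyP => i; apply: polyC_inj.
by have /polyP/(_ i) := congr1 xycoef e; rewrite !xycoef_evy !coef_map.
Qed.

Definition ymon f d := xyval (f%:P * 'X^d).
Lemma coef_ymon f d j : (xycoef (ymon f d))`_j = if j == d then f else 0.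
Proof. by rewrite /ymon xyvalK coefCM coefXn; case: eqP; rewrite ?mulr1 ?mulr0. Qed.
Lemma ysize_ymon f d : (ysize (ymon f d) <= d.+1)%N.
Proof.
by apply/leq_sizeP => j ltdj; rewrite coef_ymon gtn_eqF.
Qed.

(** The filtration by degree in x, as opposed to [ysize]. *)
Definition xbounded n (a : A) := forall j, leq (size (xycoef a)`_j) n.

Lemma coefs_finite N D : exists (I : finType) (e : I -> A), forall w,
  (ysize w <= N)%N -> xbounded D w ->
  exists c : I -> k, w = \sum_i c i *: e i.
Proof.
exists ('I_N * 'I_D)%type, (fun p : 'I_N * 'I_D => ymon 'X^(p.2) p.1) => w leN leD.
exists (fun p : 'I_N * 'I_D => (xycoef w)`_(p.1)`_(p.2)).
rewrite -(pair_bigA _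
  (fun (j : 'I_N) (i : 'I_D) => (xycoef w)`_j`_i *: ymon 'X^i j)) /=.
apply: eq_from_xycoef => j; rewrite raddf_sum coef_sum /=.
have xycoef_row (l : 'I_N) :
    (xycoef (\sum_(i < D) (xycoef w)`_l`_i *: ymon 'X^i l))`_j =
    if j == l then (xycoef w)`_l else 0.
  rewrite raddf_sum coef_sum /=.
  under eq_bigr do rewrite xycoefZ coefCM coef_ymon.
  case: eqP => _; last by rewrite big1 // => i _; rewrite mulr0.
  under eq_bigr do rewrite mul_polyC.
  rewrite -(poly_def D (fun i => (xycoef w)`_l`_i)).
  apply/polyP => i; rewrite coef_poly; case: ltnP => // leDi.
  by rewrite nth_default ?(leq_trans (leD _)).
under eq_bigr do rewrite xycoef_row.
case: (ltnP j N) => [ltjN|leNj].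
  rewrite (bigD1 (Ordinal ltjN)) //= eqxx big1 ?addr0 // => l.
  by rewrite -val_eqE eq_sym /= => /negPf->.
rewrite big1 => [|l _]; first by rewrite nth_default ?(leq_trans leN).
by rewrite gtn_eqF // (leq_trans (ltn_ord l)).
Qed.

(** * Leading coefficients in y, division and Ore conditions *)

(** Moving f(x) to the left across a power of y changes only the coefficients of
    lower powers of y. *)
Lemma coef_mul_ev a f j : (ysize a <= j.+1)%N ->
  (xycoef (a * ev x f))`_j = (xycoef a)`_j * f.
Proof.
elim/poly_ind: f j => [|f c IH] j lej; first by rewrite !raddf0 !mulr0 raddf0 coef0.
rewrite raddfD /= rmorphM /= evX evC mulrDr mulr_algr mulrA raddfD /=.
rewrite xycoef_mulx xycoefZ.
rewrite coefD coefB !coefCM coef_deriv !IH ?(leq_trans lej) //.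
rewrite [(xycoef a)`_j.+1]nth_default // mul0r mul0rn subr0 mulrDr.
by rewrite mulrCA ['X * f]mulrC [c%:P * _]mulrC.
Qed.

(** For j = m + n this is multiplicativity of leading coefficients in y; for
    larger j both sides vanish, which gives the bound on the degree of a
    product. *)
Lemma coef_mul a b m n j : (ysize a <= m.+1)%N -> (ysize b <= n.+1)%N ->
  (m + n <= j)%N -> (xycoef (a * b))`_j = (xycoef a)`_(j - n) * (xycoef b)`_n.
Proof.
move=> lea; rewrite /ysize -{2}[b]xycoefK; move: (xycoef b) => v {b}.
elim: n v j => [|n IH] v j lev lej.
  rewrite (size1_polyC lev) xyvalC coef_mul_ev ?subn0 ?coefC //.
  by rewrite (leq_trans lea) // ltnS -(addn0 m).
case: j lej => [|j]; rewrite ?addnS // ltnS => lej.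
have -> : v = \poly_(i < n.+1) v`_i.+1 * 'X + (v`_0)%:P.
  apply/polyP => -[|i]; rewrite coefD coefMX coefC /= ?add0r // coef_poly addr0.
  by case: ltnP => // leni; rewrite nth_default // (leq_trans lev).
rewrite raddfD /= xyvalMX xyvalC mulrDr mulrA raddfD /= xycoef_muly coefD coefMX /=.
rewrite IH ?size_poly // coef_mul_ev; last first.
  by rewrite (leq_trans lea) // ltnS ltnW // ltnS (leq_trans _ lej) ?leq_addr.
rewrite [(xycoef a)`_j.+1]nth_default; last first.
  by rewrite (leq_trans lea) // ltnS (leq_trans _ lej) ?leq_addr.
by rewrite mul0r addr0 subSS coefD coefMX coefC addr0.
Qed.

Lemma weyl_domain (a b : A) : a * b = 0 -> a = 0 \/ b = 0.
Proof.
move=> ab0; have [->|nz_a] := eqVneq a 0; [by left | right].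
apply/eqP; apply: contraT => nz_b.
have := @coef_mul a b _ _ _ (leqSpred _) (leqSpred _) (leqnn _).
rewrite ab0 raddf0 coef0 addnK => /esym/eqP.
by rewrite mulf_eq0 !lead_coef_eq0 !xycoef_eq0 (negPf nz_a) (negPf nz_b).
Qed.

Lemma ev_neq0 f : (ev x f != 0) = (f != 0).
Proof. by rewrite -(raddf0 (ev x)) (inj_eq ev_inj). Qed.

Lemma ysize_lt a n :
  (forall j, (n <= j)%N -> (xycoef a)`_j = 0) -> (ysize a < n.+1)%N.
Proof. by move=> H; rewrite ltnS; apply/leq_sizeP. Qed.

(** The leading coefficients of a and b are polynomials in x, hence commute:
    multiplying each element by the leading coefficient of the other cancels
    the top terms. *)
Lemma right_pdiv (a b : A) : a != 0 -> b != 0 -> (ysize a <= ysize b)%N ->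
  exists g c, g != 0 /\ (ysize (b * ev x g - a * c)%R < ysize b)%N.
Proof.
rewrite -!ysize_gt0; case da: (ysize a) => [//|m] _.
case db: (ysize b) => [//|n] _; rewrite ltnS => lemn.
exists (xycoef a)`_m, (ymon (xycoef b)`_n (n - m)); split.
  by rewrite -[m]/(m.+1.-1) -da lead_coef_eq0 -size_poly_gt0 [size _]da.
apply: ysize_lt => j lenj; rewrite raddfB /= coefB coef_mul_ev ?db //.
rewrite (@coef_mul _ _ m (n - m)) ?da ?ysize_ymon ?subnKC // coef_ymon eqxx.
move: lenj; rewrite leq_eqVlt => /predU1P[<-|ltnj].
  by rewrite subKn // mulrC subrr.
rewrite [(xycoef b)`_j]nth_default ?[size _]db //.
rewrite [(xycoef a)`_(_ - _)%N]nth_default.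
  by rewrite !mul0r subrr.
by rewrite [size _]da; lia.
Qed.

Lemma left_pdiv (a b : A) : a != 0 -> b != 0 -> (ysize a <= ysize b)%N ->
  exists g c, g != 0 /\ (ysize (ev x g * b - c * a)%R < ysize b)%N.
Proof.
rewrite -!ysize_gt0; case da: (ysize a) => [//|m] _.
case db: (ysize b) => [//|n] _; rewrite ltnS => lemn.
exists (xycoef a)`_m, (ymon (xycoef b)`_n (n - m)); split.
  by rewrite -[m]/(m.+1.-1) -da lead_coef_eq0 -size_poly_gt0 [size _]da.
apply: ysize_lt => j lenj; rewrite raddfB /= coefB xycoef_evM coefCM.
rewrite (@coef_mul _ _ (n - m) m) ?da ?ysize_ymon ?subnK // coef_ymon.
move: lenj; rewrite leq_eqVlt => /predU1P[<-|ltnj].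
  by rewrite eqxx mulrC subrr.
rewrite [(xycoef b)`_j]nth_default ?[size _]db //.
rewrite (_ : (j - m == n - m)%N = false); last by lia.
by rewrite mulr0 mul0r subrr.
Qed.

Lemma right_ore (a b : A) : b != 0 -> exists b' a', b' != 0 /\ a * b' = b * a'.
Proof.
apply: (@ore_of_pdiv A ysize weyl_domain) => {}a {}b nz_a nz_b leab.
have [g [c [nz_g lt_r]]] := right_pdiv nz_a nz_b leab.
by exists (ev x g), c; rewrite ev_neq0.
Qed.

Lemma left_ore (a b : A) : b != 0 -> exists b' a', b' != 0 /\ b' * a = a' * b.
Proof.
apply: (@ore_of_pdiv A^c ysize) => [a0 b0 /weyl_domain[]|{}a {}b nz_a nz_b leab];
  [by right | by left |].
have [g [c [nz_g lt_r]]] := left_pdiv nz_a nz_b leab.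
by exists (ev x g), c; rewrite ev_neq0.
Qed.

(** A common left denominator for finitely many fractions, with denominators
    taken from a multiplicative set S.  It is applied to the nonzero elements
    of A and to the nonzero polynomials in x. *)
Lemma common_left_multiple (S : A -> Prop) : S 1 ->
  (forall a b, S a -> S b -> S (a * b)) ->
  (forall a b, S b -> exists h c, S h /\ h * a = c * b) ->
  forall n (a b : 'I_n -> A), (forall i, S (b i)) ->
  exists h, S h /\ forall i, exists c, h * a i = c * b i.
Proof.
move=> S1 SM oreS n a b Sb.
suff [h [Sh hP]] : exists h, S h /\
    {in enum 'I_n, forall i, exists c, h * a i = c * b i}.
  by exists h; split=> // i; apply: hP; rewrite mem_enum.
elim: (enum 'I_n) => [|i s [h [Sh IH]]]; first by exists 1.
have [g [c [Sg e]]] := oreS (h * a i) (b i) (Sb i).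
exists (g * h); split; first exact: SM.
move=> j; rewrite inE => /predU1P[->|/IH[c' e']].
  by exists c; rewrite -mulrA.
by exists (g * c'); rewrite -!mulrA e'.
Qed.

(** The nonzero polynomials in x form a left Ore set by themselves: crossing one
    factor y costs one more factor f, because of [ev_muly]. *)
Lemma left_ore_ev (a : A) (f : kX) : f != 0 ->
  exists (h : kX) (c : A), h != 0 /\ ev x h * a = c * ev x f.
Proof.
rewrite -[a]xycoefK; elim/poly_ind: (xycoef a) f => [|u g IH] f nz_f.
  by exists 1, 0; rewrite oner_neq0 raddf0 mulr0 mul0r.
have [h [c [nz_h e]]] := IH (f * f) (mulf_neq0 nz_f nz_f).
exists (f * h), (ev x f * c * (ev x f * y + ev x f^`()) + ev x (h * g)).
split; first exact: mulf_neq0.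
rewrite raddfD /= xyvalMX xyvalC !rmorphM /= mulrDr !mulrA -(mulrA (ev x f)) e.
rewrite rmorphM /= mulrDl; congr (_ + _).
  rewrite -!mulrA; congr (_ * (_ * _)).
  by rewrite {1}(ev_muly f) mulrDr mulrDl -!rmorphM /= mulrC !mulrA.
by rewrite -!rmorphM /= -mulrA mulrC.
Qed.

(** * Rank one modules as right ideals meeting k[x] *)

Section RankOneModule.

Variable M : lmodType A^c.

Definition ract (m : M) (a : A) : M := (a : A^c) *: m.
Local Notation "m <* a" := (ract m a) (at level 40, left associativity).

Lemma ractA m a b : m <* a <* b = m <* (a * b).
Proof. by rewrite /ract scalerA. Qed.
Lemma ract1 m : m <* 1 = m.
Proof. exact: scale1r. Qed.
Lemma ract0 m : m <* 0 = 0.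
Proof. exact: scale0r. Qed.
Lemma ract0l a : 0 <* a = 0.
Proof. exact: scaler0. Qed.
Lemma ractDr m a b : m <* (a + b) = m <* a + m <* b.
Proof. exact: scalerDl. Qed.
Lemma ractDl m n a : (m + n) <* a = m <* a + n <* a.
Proof. exact: scalerDr. Qed.
Lemma ractN m a : m <* (- a) = - (m <* a).
Proof. exact: scaleNr. Qed.
Lemma ractBl m n a : (m - n) <* a = m <* a - n <* a.
Proof. exact: scalerBr. Qed.

Definition right_linear (th : M -> A) :=
  forall a m n, th (m <* a + n) = th m * a + th n.

Section RightLinear.
Variables (th : M -> A) (thL : right_linear th).
Lemma rlinD m n : th (m + n) = th m + th n.
Proof. by have := thL 1 m n; rewrite ract1 mulr1. Qed.
Lemma rlin0 : th 0 = 0.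
Proof. by apply: (addrI (th 0)); rewrite -rlinD !addr0. Qed.
Lemma rlinM m a : th (m <* a) = th m * a.
Proof. by rewrite -[m <* a]addr0 thL rlin0 addr0. Qed.
Lemma rlinB m n : th (m - n) = th m - th n.
Proof. by apply/eqP; rewrite eq_sym subr_eq -rlinD subrK. Qed.
End RightLinear.

Hypothesis tfM : torsion_free M.

Lemma ract_eq0 m a : m <* a = 0 -> a = 0 \/ m = 0.
Proof. exact: tfM. Qed.
Lemma ract_neq0 (m : M) (a : A) : m != 0 -> m <* a = 0 -> a = 0.
Proof. by move=> nz_m /ract_eq0[//|/eqP]; rewrite (negPf nz_m). Qed.

(** If every element of M is a right fraction m0 a b^-1, the assignment of d to
    m0 extends to M as soon as the fractions d a b^-1 of the generators lie in
    A.  The extension is built as a graph [G], which avoids introducing the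
    field of fractions; right common multiples show that [G] is a submodule. *)
Lemma extend_embedding n (e : 'I_n -> M) (m0 : M) (d : A) :
  (forall m : M, exists a : 'I_n -> A^c, m = \sum_(i < n) a i *: e i) ->
  m0 != 0 -> d != 0 ->
  (forall i, exists a b c, [/\ b != 0, e i <* b = m0 <* a & c * b = d * a]) ->
  exists th, [/\ right_linear th, forall m, th m = 0 -> m = 0 & th m0 = d].
Proof.
move=> genM nz_m0 nz_d gen_e.
pose G (m : M) (c : A) :=
  exists a b, [/\ b != 0, m <* b = m0 <* a & c * b = d * a].
have G0 : G 0 0.
  by exists 0, 1; rewrite oner_neq0 ract0l ract0 mul0r mulr0.
have Gm0 : G m0 d by exists 1, 1; rewrite oner_neq0.
have GD m c m' c' : G m c -> G m' c' -> G (m + m') (c + c').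
  move=> [a [b [nz_b e1 e2]]] [a' [b' [nz_b' e1' e2']]].
  have [u [v [nz_u uv]]] := right_ore b nz_b'.
  exists (a * u + a' * v), (b * u); split.
  - by apply/eqP => /weyl_domain[] /eqP; apply/negP.
  - have e1u : m <* (b * u) = m0 <* (a * u) by rewrite -ractA e1 ractA.
    have e1v : m' <* (b * u) = m0 <* (a' * v) by rewrite uv -ractA e1' ractA.
    by rewrite ractDl e1u e1v -ractDr.
  - by rewrite mulrDl {2}uv !mulrA e2 e2' -!mulrA -mulrDr.
have Gact m c t : G m c -> G (m <* t) (c * t).
  move=> [a [b [nz_b e1 e2]]]; have [u [v [nz_u uv]]] := right_ore t nz_b.
  exists (a * v), u; split => //.
    by rewrite ractA uv -!ractA e1.
  by rewrite -mulrA uv !mulrA e2.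
have Gker c : G 0 c -> c = 0.
  move=> [a [b [nz_b]]]; rewrite ract0l => /esym/(ract_neq0 nz_m0)->.
  by rewrite mulr0 => /weyl_domain[//|/eqP]; rewrite (negPf nz_b).
have Ginj m : G m 0 -> m = 0.
  move=> [a [b [nz_b e1]]]; rewrite mul0r => /esym/weyl_domain[/eqP|a0].
    by rewrite (negPf nz_d).
  by move: e1; rewrite a0 ract0 => /ract_eq0[/eqP|//]; rewrite (negPf nz_b).
have Guniq m c c' : G m c -> G m c' -> c = c'.
  move=> Gc /(@Gact _ _ (-1)); rewrite mulrN1 ractN ract1 => /(GD _ _ _ _ Gc).
  by rewrite subrr => /Gker/subr0_eq.
have Gtot m : exists c, G m c.
  have [a ->] := genM m.
  elim/big_rec: _ => [|i m' _ [c' Gc']]; first by exists 0.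
  have [a0 [b0 [c0 e0]]] := gen_e i.
  by exists (c0 * a i + c'); apply: GD => //; apply: Gact; exists a0, b0.
have [th thG] := choice Gtot.
exists th; split.
- by move=> a m m'; apply: (Guniq _ _ _ (thG _)); apply/GD => //; apply: Gact.
- by move=> m th0; apply: Ginj; rewrite -th0.
- exact: Guniq (thG _) Gm0.
Qed.

Hypothesis fgM : finitely_generated M.
Hypothesis rankM : has_rank M 1.

(** Rank one makes every element of M a right fraction of a fixed m0; the image
    d of m0 is a common left denominator of the generators. *)
Lemma embeds_in_weyl :
  exists th, [/\ right_linear th, forall m, th m = 0 -> m = 0 &
                 exists m, th m != 0].
Proof.
have [n [e genM]] := fgM.
have [[e0 free_e0] rank_le] := rankM.
pose m0 := e0 ord0.
have nz_m0 : m0 != 0.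
  apply/eqP => m00; suff /eqP : 1 = 0 :> A^c by rewrite oner_eq0.
  by apply: (free_e0 (fun=> 1) _ ord0); rewrite big_ord1 -/m0 m00 scaler0.
(* In a dependence between m0 and m, the coefficient of m is nonzero because m0
   has no torsion. *)
have ratM m : exists b a, b != 0 /\ m <* b = m0 <* a.
  apply: contrapT => no_ba; apply: (rank_le (fun i => if i == ord0 then m0 else m)).
  move=> a; rewrite big_ord_recl big_ord1 /= => rel.
  have a10 : a (lift ord0 ord0) = 0.
    apply/eqP; apply: contraPT no_ba => nz_a; apply.
    exists (a (lift ord0 ord0)), (- a ord0).
    by split=> //; apply/eqP; rewrite ractN -addr_eq0 addrC /ract rel.
  have a00 : a ord0 = 0.
    by apply: (ract_neq0 nz_m0); move: rel; rewrite a10 scale0r addr0.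
  by move=> i; case: (unliftP ord0 i) => [j|] ->; rewrite ?(ord1 j).
have [b bP] := choice (fun i => ratM (e i)).
have [a abP] := choice bP.
have [||||h [nz_h hP]] := @common_left_multiple (fun c => c != 0) _ _ _ _ a b.
- exact: oner_neq0.
- by move=> c c' nz_c nz_c'; apply/eqP => /weyl_domain[] /eqP; apply/negP.
- exact: left_ore.
- by move=> i; have [] := abP i.
have [i|th [thL thI th0]] := extend_embedding genM nz_m0 nz_h.
  have [nz_b e1] := abP i; have [c e2] := hP i.
  by exists (a i), (b i), c.
by exists th; split=> //; exists m0; rewrite th0.
Qed.

(** Take s in M whose image has least y-degree.  Pseudo-division by s leaves no
    remainder, so every m satisfies m f(x) = s a with f nonzero.  Hence only
    denominators from k[x] occur over s, and they can be cleared by some h(x) on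
    the left. *)
Lemma embeds_with_polynomial :
  exists th s h, [/\ right_linear th, forall m, th m = 0 -> m = 0,
                     h != 0 & th s = ev x h].
Proof.
have [th [thL thI [m1 nz_m1]]] := embeds_in_weyl.
have [s [nz_s s_min]] : exists s, th s != 0 /\
    forall m, th m != 0 -> (ysize (th s) <= ysize (th m))%N.
  have exn : exists n, `[< exists2 m, th m != 0 & ysize (th m) = n >].
    by exists (ysize (th m1)); apply/asboolP; exists m1.
  case: (ex_minnP exn) => n /asboolP[s nz_s <-] n_min.
  by exists s; split=> // m nz_m; apply: n_min; apply/asboolP; exists m.
have rat_s m : exists a f, f != 0 /\ m <* ev x f = s <* a.
  have [n] := ubnP (ysize (th m)); elim: n m => // n IH m; rewrite ltnS => lemn.
  have [/thI->|nz_m] := eqVneq (th m) 0.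
    by exists 0, 1; rewrite oner_neq0 ract0l ract0.
  have [g [c [nz_g lt_r]]] := right_pdiv nz_s nz_m (s_min _ nz_m).
  have [|a [f [nz_f e]]] := IH (m <* ev x g - s <* c).
    by apply: leq_trans lemn; rewrite rlinB // !rlinM.
  exists (c * ev x f + a), (g * f); split; first exact: mulf_neq0.
  rewrite rmorphM /= -ractA; move: e; rewrite ractBl => /eqP.
  rewrite subr_eq => /eqP->.
  by rewrite ractA -ractDr addrC.
have [n [e genM]] := fgM.
have [a aP] := choice (fun i => rat_s (e i)).
have [f afP] := choice aP.
pose isev (c : A) := exists2 h : kX, h != 0 & c = ev x h.
have [||||_ [[h nz_h ->] hP]] :=
  @common_left_multiple isev _ _ _ _ a (fun i => ev x (f i)).
- by exists 1; rewrite ?oner_neq0 ?rmorph1.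
- move=> _ _ [h nz_h ->] [h' nz_h' ->]; exists (h * h'); first exact: mulf_neq0.
  by rewrite rmorphM.
- move=> b _ [h' nz_h' ->]; have [h [c [nz_h e1]]] := left_ore_ev b nz_h'.
  by exists (ev x h), c; split=> //; exists h.
- by move=> i; have [nz_f _] := afP i; exists (f i).
have nz_s' : s != 0 by apply: contra_neq nz_s => ->; rewrite rlin0.
have nz_h' : ev x h != 0 by rewrite ev_neq0.
have [i|th' [th'L th'I th's]] := extend_embedding genM nz_s' nz_h'.
  have [nz_f e1] := afP i; have [c e2] := hP i.
  by exists (a i), (ev x (f i)), c; rewrite ev_neq0.
by exists th', s, h.
Qed.

(** * Polynomial part of a fractional ideal *)

(** Here r is the future quasi-isomorphism from M to K0 = A, and rho is the
    correction to right multiplication by x that K0 needs on the range of r. *)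
Record almost_linear_embedding (r : M -> A) (rho : M -> kX) : Prop := {
  aleD : forall m n, r (m + n) = r m + r n;
  aleZ : forall c m, r (m <* c%:A) = c *: r m;
  ale_y : forall m, r (m <* y) = r m * y;
  ale_x : forall m, r (m <* x) = r m * x + ev y (rho m);
  ale_ker : forall m, r m = 0 -> m = 0;
  ale_cofinite : exists (I : finType) (e : I -> A), forall a,
    exists m c, a = r m + \sum_i (c i : k) *: e i
}.

Lemma ysize_mul_ev a f : (ysize (a * ev x f) <= ysize a)%N.
Proof.
apply/leq_sizeP => j lej; rewrite coef_mul_ev ?(leqW lej) //.
by rewrite nth_default ?mul0r.
Qed.

Section PolynomialPart.

Variables (th : M -> A) (s : M) (h : kX).
Hypothesis thL : right_linear th.
Hypothesis thI : forall m, th m = 0 -> m = 0.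
Hypothesis nz_h : h != 0.
Hypothesis th_s : th s = ev x h.

(** Each level is an ideal of k[x]; the levels grow with n, because the image of
    th is stable under y, and they all contain h. *)
Definition level n (f : kX) :=
  exists m, (ysize (th m) <= n.+1)%N /\ (xycoef (th m))`_n = f.

Lemma level_mono n n' f : (n <= n')%N -> level n f -> level n' f.
Proof.
move=> /subnKC <-; elim: (n' - n)%N => [|d IH]; first by rewrite addn0.
move=> /IH[m [lem <-]]; exists (m <* y); rewrite (rlinM thL) addnS.
rewrite /ysize xycoef_muly coefMX; split=> //.
by rewrite (leq_trans (size_polyMleq _ _)) // size_polyX addn2.
Qed.

Lemma levelB n f f' : level n f -> level n f' -> level n (f - f').
Proof.
move=> [m [lem <-]] [m' [lem' <-]]; exists (m - m').
rewrite (rlinB thL) /ysize raddfB /= coefB; split=> //.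
rewrite (leq_trans (size_polyD _ _)) // size_polyN geq_max.
by apply/andP; split.
Qed.

Lemma levelM n f f' : level n f -> level n (f * f').
Proof.
move=> [m [lem <-]]; exists (m <* ev x f'); rewrite (rlinM thL) coef_mul_ev //.
by rewrite (leq_trans (ysize_mul_ev _ _)).
Qed.

Lemma level_h n : level n h.
Proof.
apply: (@level_mono 0) => //; exists s; rewrite th_s /ysize xycoef_ev coefC.
by rewrite size_polyC_leq1.
Qed.

(** A nonzero element g of least degree among all levels generates the union of
    the levels.  It lies in some level n0, so all the levels from n0 on are
    equal to g k[x]. *)
Lemma level_generator : exists g n0,
  [/\ g != 0, forall n f, level n f -> g %| f &
      forall n f, (n0 <= n)%N -> level n (f * g)].
Proof.
have exn : exists d, `[< exists2 g, g != 0 & exists2 n, level n g & size g = d >].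
  exists (size h); apply/asboolP; exists h => //.
  by exists 0%N => //; apply: level_h.
case: (ex_minnP exn) => d /asboolP[g nz_g [n0 lev_g <-]] g_min.
exists g, n0; split=> // [n f lev_f|n f len]; last first.
  by rewrite mulrC; apply: levelM; apply: level_mono lev_g.
rewrite /dvdp; apply: contraT => nz_r.
have := ltn_modpN0 f nz_g; rewrite ltnNge => /negP[].
apply: g_min; apply/asboolP; exists (f %% g) => //.
exists (maxn n n0) => //; have -> : f %% g = f - g * (f %/ g).
  by rewrite {2}(divp_eq f g) mulrC addrC addKr.
apply: levelB; last apply: levelM.
  by apply: level_mono lev_f; apply: leq_maxl.
by apply: level_mono lev_g; apply: leq_maxr.
Qed.

Variables (g : kX) (n0 : nat).
Hypothesis nz_g : g != 0.
Hypothesis level_dvd : forall n f, level n f -> g %| f.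
Hypothesis level_full : forall n f, (n0 <= n)%N -> level n (f * g).

Definition quo (u : kXY) : kXY := map_poly (fun f => f %/ g) u.

Lemma coef_quo u j : (quo u)`_j = u`_j %/ g.
Proof. by rewrite coef_map_id0 ?div0p. Qed.

(** The polynomial part of g^-1 th(m), coefficient by coefficient. *)
Definition polypart (m : M) : A := xyval (quo (xycoef (th m))).

Lemma xycoef_polypart m j : (xycoef (polypart m))`_j = (xycoef (th m))`_j %/ g.
Proof. by rewrite xyvalK coef_quo. Qed.

(** The errors of the coefficientwise divisions are constants by
    [size_divp_mulX], so nothing is lost by keeping only their coefficients of
    degree 0. *)
Definition polypart_defect (m : M) : kX :=
  \poly_(j < size (xycoef (th m)))
    (('X * (xycoef (th m))`_j) %/ g - 'X * ((xycoef (th m))`_j %/ g))`_0.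

Lemma polypart_mulx m :
  polypart (m <* x) = polypart m * x + ev y (polypart_defect m).
Proof.
apply: eq_from_xycoef => j.
rewrite xycoef_polypart (rlinM thL) raddfD /= !xycoef_mulx !(coefB, coefD).
rewrite !coefCM !coef_deriv !xycoef_polypart xycoef_evy coef_map coef_poly /=.
have -> : (if (j < size (xycoef (th m)))%N then
   ('X * (xycoef (th m))`_j %/ g - 'X * ((xycoef (th m))`_j %/ g))`_0 else 0)%:P
   = 'X * (xycoef (th m))`_j %/ g - 'X * ((xycoef (th m))`_j %/ g).
  case: ltnP => [_|le]; first by rewrite -size1_polyC ?size_divp_mulX.
  by rewrite nth_default // mulr0 div0p mulr0 subrr.
rewrite divpD divpN -scaler_nat divpZl scaler_nat.
by rewrite [RHS]addrC subrKA.
Qed.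

Lemma polypartD m n : polypart (m + n) = polypart m + polypart n.
Proof.
apply: eq_from_xycoef => j.
by rewrite raddfD coefD /= !xycoef_polypart (rlinD thL) raddfD coefD divpD.
Qed.

(** Leading coefficients are divisible by g, so they survive the truncation. *)
Lemma polypart_ker m : polypart m = 0 -> m = 0.
Proof.
move=> r0; apply: thI; apply/eqP; apply: contraT; rewrite -xycoef_eq0 => nz_m.
have lev_m : level (size (xycoef (th m))).-1 (lead_coef (xycoef (th m))).
  by exists m; rewrite /ysize leqSpred.
have := divpK (level_dvd lev_m); rewrite -xycoef_polypart r0 raddf0 coef0 mul0r.
by move/esym/eqP; rewrite lead_coef_eq0 (negPf nz_m).
Qed.

(** From degree n0 on, all leading coefficients are attained.  Below n0, the
    elements s q(x) y^n have image (h/g) q y^n, so the coefficients can be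
    reduced modulo h/g.  What remains is bounded in both degrees. *)
Lemma polypart_cofinite : exists (I : finType) (e : I -> A), forall a,
    exists m c, a = polypart m + \sum_i (c i : k) *: e i.
Proof.
pose D := size (h %/ g).
pose small (w : A) := (ysize w <= n0)%N /\ xbounded D w.
have smallD w w' : small w -> small w' -> small (w + w').
  move=> [lew szw] [lew' szw']; split=> [|j]; rewrite /ysize raddfD /= ?coefD;
    apply: leq_trans (size_polyD _ _) _; rewrite geq_max.
    by apply/andP; split.
  by rewrite szw szw'.
have small0 : small 0.
  by split=> [|j]; rewrite /ysize raddf0 ?coef0 size_poly0.
have g_h : g %| h := level_dvd (level_h 0).
have nz_h1 : h %/ g != 0 
  by apply: contra_neq nz_h => h10; rewrite -(divpK g_h) h10 mul0r.
(* Every leading term is attained by a truncated element plus a small one. *)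
have lead n f : exists m w, [/\ small w, (ysize (polypart m + w)%R <= n.+1)%N &
    (xycoef (polypart m + w))`_n = f].
  case: (leqP n0 n) => [len|ltn].
    have [m [lem coefm]] := level_full f len.
    exists m, 0; rewrite addr0 xycoef_polypart coefm mulpK //; split=> //.
    apply/leq_sizeP => j ltnj; rewrite xycoef_polypart nth_default ?div0p //.
    exact: leq_trans lem _.
  pose t := f %% (h %/ g); pose q := f %/ (h %/ g).
  have xycoef_m j : (xycoef (polypart (s <* ymon q n)))`_j =
      if j == n then q * (h %/ g) else 0.
    rewrite xycoef_polypart (rlinM thL) th_s xycoef_evM coefCM coef_ymon.
    by case: eqP => _; rewrite ?mulr0 ?div0p // mulrC divp_mulA.
  exists (s <* ymon q n), (ymon t n).
  rewrite raddfD coefD /= xycoef_m coef_ymon eqxx.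
  split; last by rewrite -divp_eq.
    split=> [|j]; first exact: leq_trans (ysize_ymon _ _) _.
    by rewrite coef_ymon; case: eqP; rewrite ?size_poly0 // ltnW ?ltn_modpN0.
  apply/leq_sizeP => j ltnj; rewrite raddfD coefD /= xycoef_m coef_ymon gtn_eqF //.
  by rewrite addr0.
have all_small a : exists m w, small w /\ a = polypart m + w.
  have [N] := ubnP (ysize a); elim: N a => // N IH a; rewrite ltnS => leN.
  case da: (ysize a) leN => [|n] leN.
    exists 0, 0; split=> //; rewrite addr0; apply: eq_from_xycoef => j.
    rewrite xycoef_polypart (rlin0 thL) raddf0 coef0 div0p.
    by rewrite nth_default // [size _]da.
  have [m [w [sw ler lead_r]]] := lead n (xycoef a)`_n.
  have [|m' [w' [sw' e]]] := IH (a - (polypart m + w)).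
    apply: leq_trans leN; apply: ysize_lt => j; rewrite raddfB /= coefB leq_eqVlt.
    case/predU1P => [<-|ltnj]; first by rewrite lead_r subrr.
    by rewrite !nth_default ?subr0 // ?[size _]da // (leq_trans ler).
  exists (m' + m), (w' + w); split; first exact: smallD.
  by rewrite polypartD addrACA -e subrK.
have [I [e eP]] := coefs_finite n0 D; exists I, e => a.
have [m [w [[lew szw] ->]]] := all_small a.
by have [c ->] := eP _ lew szw; exists m, c.
Qed.

Lemma polypart_embedding : almost_linear_embedding polypart polypart_defect.
Proof.
split; [exact: polypartD | | | exact: polypart_mulx | exact: polypart_ker |
  exact: polypart_cofinite] => [c m|m]; apply: eq_from_xycoef => j.
  rewrite xycoef_polypart (rlinM thL) mulr_algr !xycoefZ !coefCM !mul_polyC divpZl.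
  by rewrite xycoef_polypart.
rewrite xycoef_polypart (rlinM thL) !xycoef_muly !coefMX xycoef_polypart.
by case: eqP; rewrite ?div0p.
Qed.

End PolynomialPart.

Lemma almost_linear_embedding_exists : exists r rho, almost_linear_embedding r rho.
Proof.
have [th [s [h [thL thI nz_h th_s]]]] := embeds_with_polynomial.
have [g [n0 [nz_g g_dvd g_full]]] := level_generator thL nz_h th_s.
exists (polypart th g), (polypart_defect th g).
exact: (polypart_embedding thL thI nz_h th_s nz_g g_dvd g_full).
Qed.

(** * Extending the defect from the module to the algebra *)

Section DefectExtension.

Variables (r : M -> A) (rho : M -> kX).
Hypothesis rP : almost_linear_embedding r rho.

Let rD := aleD rP.

Lemma ale0 : r 0 = 0.
Proof. by apply: (addrI (r 0)); rewrite -rD !addr0. Qed.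

Lemma ale_inj : injective r.
Proof.
move=> m n e; apply/subr0_eq/(ale_ker rP)/(addIr (r n)).
by rewrite -rD subrK add0r.
Qed.

Lemma rhoD m n : rho (m + n) = rho m + rho n.
Proof.
apply: ev_y_inj; apply: (addrI (r (m + n) * x)).
by rewrite -(ale_x rP) ractDl rD !(ale_x rP) rD mulrDl raddfD addrACA.
Qed.

Lemma ractC (m : M) (c : k) a : m <* c%:A <* a = m <* a <* c%:A.
Proof. by rewrite !ractA mulr_algl mulr_algr. Qed.

Lemma rhoZ c m : rho (m <* c%:A) = c *: rho m.
Proof.
apply: ev_y_inj; apply: (addrI (r (m <* c%:A) * x)).
rewrite -(ale_x rP) ractC !(aleZ rP) (ale_x rP) scalerDr -scalerAl.
by rewrite -mul_polyC rmorphM /= evC mulr_algl.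
Qed.

(** Compare r(m y x) with r(m (x y - 1)). *)
Lemma rho_y m : rho (m <* y) = rho m * 'X.
Proof.
apply: ev_y_inj; apply: (addrI (r (m <* y) * x)).
rewrite -(ale_x rP) ractA mulyx ractDr ractN ract1 -ractA rD !(ale_y rP) (ale_x rP).
have -> : r (- m) = - r m by apply: (addIr (r m)); rewrite -rD !addNr ale0.
by rewrite -mulrA mulyx mulrBr mulr1 !mulrDl rmorphM /= evX mulrA addrAC.
Qed.

Lemma ale_evy m q : r (m <* ev y q) = r m * ev y q.
Proof.
elim/poly_ind: q => [|q c IH]; first by rewrite raddf0 mulr0 ract0 ale0.
rewrite raddfD /= rmorphM /= evX evC ractDr -ractA rD (ale_y rP) IH (aleZ rP).
by rewrite mulrDr mulr_algr mulrA.
Qed.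

Lemma rho_evy m q : rho (m <* ev y q) = rho m * q.
Proof.
have rho0 : rho 0 = 0 by apply: (addrI (rho 0)); rewrite -rhoD !addr0.
elim/poly_ind: q => [|q c IH]; first by rewrite raddf0 mulr0 ract0.
rewrite raddfD /= rmorphM /= evX evC ractDr -ractA rhoD rho_y IH rhoZ.
by rewrite mulrDr mulrA [_ * c%:P]mulrC mul_polyC.
Qed.

Definition in_range (a : A) := exists m, r m = a.

Lemma in_range_lin (c : k) a b : in_range a -> in_range b -> in_range (c *: a + b).
Proof. by move=> [m <-] [n <-]; exists (m <* c%:A + n); rewrite rD (aleZ rP). Qed.

Lemma in_range0 : in_range 0.
Proof. by exists 0; apply: ale0. Qed.

Lemma in_range_sum (I : Type) (s : seq I) (F : I -> A) (c : I -> k) :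
  (forall i, in_range (F i)) -> in_range (\sum_(i <- s) c i *: F i).
Proof.
move=> FP; elim/big_rec: _ => [|i a _]; first exact: in_range0.
exact: in_range_lin.
Qed.

(** The elements a, a y, a y^2, ... are linearly dependent modulo the range of
    r, which has finite codimension. *)
Lemma conductor_one a : exists q, q != 0 /\ in_range (a * ev y q).
Proof.
have [I [e eP]] := ale_cofinite rP.
have [m mP] := choice (fun j => eP (a * y ^+ j)).
have [c cP] := choice mP.
pose d := #|I|; pose C := \matrix_(j < d.+1, i < d) c j (enum_val i).
have [v vC nz_v] : exists2 v : 'rV_d.+1, v *m C = 0 & v != 0.
  have : kermx C != 0.
    by rewrite -mxrank_eq0 mxrank_ker -lt0n subn_gt0 ltnS rank_leq_col.
  by move/rowV0Pn => [v /sub_kermxP]; exists v.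
exists (rVpoly v); split.
  by apply: contra_neq nz_v => v0; rewrite -[v]rVpolyK v0 raddf0.
have -> : a * ev y (rVpoly v) = \sum_(j < d.+1) v 0 j *: (a * y ^+ j).
  rewrite /rVpoly poly_def raddf_sum mulr_sumr; apply: eq_bigr => j _ /=.
  by rewrite valK evZ rmorphXn /= evX scalerAr.
under eq_bigr => j _ do rewrite cP scalerDr scaler_sumr.
rewrite big_split /= exchange_big /= [X in _ + X]big1 ?addr0; last first.
  move=> i _; under eq_bigr do rewrite scalerA.
  rewrite -scaler_suml; have /rowP/(_ (enum_rank i)) := vC.
  rewrite !mxE => vCi; rewrite [X in X *: _](_ : _ = 0) ?scale0r // -[RHS]vCi.
  by apply: eq_bigr => j _; rewrite mxE enum_rankK.
by apply: in_range_sum => j; exists (m j).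
Qed.

Lemma conductor : exists q, q != 0 /\ forall a, in_range (a * ev y q).
Proof.
have [I [e eP]] := ale_cofinite rP.
have rangeM a q : in_range a -> in_range (a * ev y q).
  by move=> [m <-]; exists (m <* ev y q); rewrite ale_evy.
suff [q [nz_q qP]] : exists q, q != 0 /\
    {in enum I, forall i, in_range (e i * ev y q)}.
  exists q; split=> // a; have [m [c ->]] := eP a.
  rewrite mulrDl mulr_suml -[X in X + _]scale1r; apply: in_range_lin.
    by apply: rangeM; exists m.
  under eq_bigr do rewrite -scalerAl.
  by apply: in_range_sum => i; apply: qP; rewrite mem_enum.
elim: (enum I) => [|i s [q [nz_q IH]]]; first by exists 1; rewrite oner_neq0.
have [p [nz_p pP]] := conductor_one (e i).
exists (p * q); split; first exact: mulf_neq0.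
move=> j; rewrite inE rmorphM /= mulrA => /predU1P[->|/IH jP]; first exact: rangeM.
by rewrite -mulrA -rmorphM /= mulrC rmorphM /= mulrA; apply: rangeM.
Qed.

Definition xi_spec (xi : A -> kX) := [/\ forall m, xi (r m) = rho m,
  forall (c : k) a b, xi (c *: a + b) = c *: xi a + xi b &
  forall a, exists c : k, xi (a * y) = xi a * 'X + c%:P].

(** Here t(a) is the preimage of a q(y), and xi(a) = rho(t(a)) / q is the
    polynomial part of the extension of rho to A with values in k(y). *)
Lemma defect_extension : exists xi, xi_spec xi.
Proof.
have [q [nz_q qP]] := conductor; have [t tP] := choice qP.
exists (fun a => rho (t a) %/ q); split=> [m|c a b|a].
- have -> : t (r m) = m <* ev y q by apply: ale_inj; rewrite tP ale_evy.
  by rewrite rho_evy mulpK.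
- have -> : t (c *: a + b) = t a <* c%:A + t b.
    by apply: ale_inj; rewrite tP rD (aleZ rP) !tP mulrDl scalerAl.
  by rewrite rhoD rhoZ divpD divpZl.
have -> : t (a * y) = t a <* y.
  by apply: ale_inj; rewrite (ale_y rP) !tP -!mulrA -ev_commute.
(* The constant is the error of dividing by q before multiplying by y. *)
rewrite rho_y; exists (('X * rho (t a)) %/ q - 'X * (rho (t a) %/ q))`_0.
by rewrite -size1_polyC ?size_divp_mulX // ![_ * 'X]mulrC addrC subrK.
Qed.

End DefectExtension.

(** * The deformed action on the algebra *)

Section DeformedAction.

Implicit Types (f g : kX) (a b u v : A).

Variable xi : A -> kX.
Hypothesis xi_lin : forall (c : k) a b, xi (c *: a + b) = c *: xi a + xi b.
Hypothesis xi_y : forall a, exists c : k, xi (a * y) = xi a * 'X + c%:P.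

Definition opX (a : A) : A := a * x + ev y (xi a).

Lemma opX_lin (c : k) a b : opX (c *: a + b) = c *: opX a + opX b.
Proof.
by rewrite /opX xi_lin raddfD /= evZ mulrDl -scalerAl scalerDr addrACA.
Qed.

(** The commutation relation holds up to a multiple of 1, with the constant
    coming from the truncation in xi. *)
Lemma opX_y a : exists c : k, opX (a * y) = opX a * y - a + c *: 1.
Proof.
have [c xi_ay] := xi_y a; exists c.
rewrite /opX xi_ay raddfD /= rmorphM /= evX evC -mulrA mulyx mulrBr mulr1 mulrA.
by rewrite mulrDl addrA; congr (_ + _); rewrite addrAC.
Qed.

Definition opX_eval (u : A) (f : kX) : A := \sum_(i < size f) f`_i *: iter i opX u.

Lemma opX_eval_wide n u f : (size f <= n)%N ->
  opX_eval u f = \sum_(i < n) f`_i *: iter i opX u.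
Proof.
move=> lef; rewrite /opX_eval (big_ord_widen n (fun i => f`_i *: iter i opX u) lef).
rewrite big_mkcond; apply: eq_bigr => i _; case: ltnP => // le.
by rewrite nth_default // scale0r.
Qed.

Lemma opX_eval_is_zmod_morphism u : zmod_morphism (opX_eval u).
Proof.
move=> f g; pose n := maxn (size f) (size g).
rewrite !(@opX_eval_wide n) ?leq_maxl ?leq_maxr //; last first.
  by rewrite (leq_trans (size_polyD _ _)) // size_polyN.
by rewrite -sumrB; apply: eq_bigr => i _; rewrite coefB scalerBl.
Qed.
HB.instance Definition _ u :=
  GRing.isZmodMorphism.Build kX A (opX_eval u) (opX_eval_is_zmod_morphism u).

Lemma opX_evalC u c : opX_eval u c%:P = c *: u.
Proof.
by rewrite (@opX_eval_wide 1) ?size_polyC_leq1 // big_ord1 coefC.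
Qed.

Lemma opX_eval_mulX u f : opX_eval u ('X * f) = opX_eval (opX u) f.
Proof.
rewrite (@opX_eval_wide (size f).+1); last first.
  by rewrite mulrC (leq_trans (size_polyMleq _ _)) // size_polyX addn2.
rewrite big_ord_recl coefXM scale0r add0r; apply: eq_bigr => i _.
by rewrite lift0 coefXM -iterSr.
Qed.

Lemma opX_evalZ u (c : k) f : opX_eval u (c *: f) = c *: opX_eval u f.
Proof.
rewrite (@opX_eval_wide (size f)) ?size_scale_leq // scaler_sumr.
by apply: eq_bigr => i _; rewrite coefZ scalerA.
Qed.

Lemma opX_eval_lin (c : k) u v f :
  opX_eval (c *: u + v) f = c *: opX_eval u f + opX_eval v f.
Proof.
rewrite scaler_sumr -big_split; apply: eq_bigr => i _ /=.
have -> : iter i opX (c *: u + v) = c *: iter i opX u + iter i opX v.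
  by elim: (nat_of_ord i) => //= n ->; apply: opX_lin.
by rewrite scalerDr !scalerA mulrC.
Qed.

(** The action of x^i y^j: first X i times, then right multiplication by y^j.
    It is associative when x comes first or y comes last, which is what makes
    m3 vanish on such pairs. *)
Definition act (u a : A) : A := (map_poly (opX_eval u) (xycoef a)).[y].

Lemma actB u a b : act u (a - b) = act u a - act u b.
Proof. by rewrite /act !raddfB hornerD hornerN. Qed.
Lemma actD u a b : act u (a + b) = act u a + act u b.
Proof. by rewrite /act !raddfD hornerD. Qed.
Lemma act_evx u f : act u (ev x f) = opX_eval u f.
Proof. by rewrite /act xycoef_ev map_polyC hornerC. Qed.
Lemma act_muly u a : act u (a * y) = act u a * y.
Proof.
rewrite /act xycoef_muly -hornerMX; congr horner.
by apply/polyP => j; rewrite coef_map !coefMX coef_map; case: eqP; rewrite ?raddf0.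
Qed.

Lemma act0 u : act u 0 = 0.
Proof. by have := actB u 0 0; rewrite !subrr. Qed.

Lemma act_mulx u a : act u (x * a) = act (opX u) a.
Proof.
elim/weyl_horner_ind: a => [|a f IH]; first by rewrite mulr0 !act0.
rewrite mulrDr mulrA !actD !act_muly IH; congr (_ + _).
by rewrite -{1}[x](evX x) -rmorphM /= !act_evx opX_eval_mulX.
Qed.

Lemma actZ u (c : k) a : act u (c *: a) = c *: act u a.
Proof.
elim/weyl_horner_ind: a => [|a f IH]; first by rewrite scaler0 !act0 scaler0.
rewrite scalerDr scalerAl !actD !act_muly IH -evZ !act_evx opX_evalZ scalerDr.
by rewrite scalerAl.
Qed.

Lemma act_linr u : linear (act u).
Proof. by move=> c a b; rewrite actD actZ. Qed.

Lemma act_linl a : linear (act^~ a).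
Proof.
move=> c u v; elim/weyl_horner_ind: a => [|a f IH].
  by rewrite !act0 scaler0 addr0.
rewrite !actD !act_muly IH !act_evx opX_eval_lin mulrDl scalerDr -scalerAl.
by rewrite addrACA.
Qed.

Lemma act1r u : act u 1 = u.
Proof. by rewrite -(rmorph1 (ev x)) act_evx opX_evalC scale1r. Qed.

Lemma act_x u : act u x = opX u.
Proof. by rewrite -[x]mulr1 act_mulx act1r. Qed.

Lemma act_y u : act u y = u * y.
Proof. by rewrite -[y]mul1r act_muly act1r mul1r. Qed.

Lemma act_yx u : exists c : k, act (act u y) x - act u (y * x) = c *: 1.
Proof.
have [c e] := opX_y u; exists c.
rewrite act_y act_x e mulyx actB act_mulx act_y act1r.
by rewrite addrC addKr.
Qed.

Lemma xboundedB n a b : xbounded n a -> xbounded n b -> xbounded n (a - b).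
Proof.
move=> an bn j; rewrite raddfB /= coefB (leq_trans (size_polyD _ _)) //.
by rewrite size_polyN geq_max an bn.
Qed.

Lemma xbounded0 n : xbounded n 0.
Proof. by move=> j; rewrite raddf0 coef0 size_poly0. Qed.

Lemma xboundedD n a b : xbounded n a -> xbounded n b -> xbounded n (a + b).
Proof.
move=> an bn; rewrite -[b]opprK -[- b]sub0r.
by do 2!apply: xboundedB => //; apply: xbounded0.
Qed.

Lemma xbounded_le n n' a : (n <= n')%N -> xbounded n a -> xbounded n' a.
Proof. by move=> le an j; apply: leq_trans le. Qed.

Lemma xbounded_y n a : xbounded n a -> xbounded n (a * y).
Proof.
by move=> an j; rewrite xycoef_muly coefMX; case: eqP; rewrite ?size_poly0.
Qed.

Lemma xboundedZ n (c : k) a : xbounded n a -> xbounded n (c *: a).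
Proof.
by move=> an j; rewrite xycoefZ coefCM mul_polyC (leq_trans (size_scale_leq _ _)).
Qed.

Lemma xbounded_x n a : xbounded n a -> xbounded n.+1 (a * x).
Proof.
move=> an j; rewrite xycoef_mulx coefB coefCM coef_deriv.
rewrite (leq_trans (size_polyD _ _)) // size_polyN geq_max; apply/andP; split.
  by rewrite (leq_trans (size_polyMleq _ _)) // size_polyX add2n ltnS.
by rewrite -scaler_nat (leq_trans (size_scale_leq _ _)) // leqW.
Qed.

Lemma xbounded_evy n q : xbounded n.+1 (ev y q).
Proof.
move=> j; rewrite xycoef_evy coef_map /=.
by rewrite (leq_trans (size_polyC_leq1 _)).
Qed.

Lemma iter_opX_triangular i : xbounded i (iter i opX 1 - x ^+ i).
Proof.
elim: i => [|i IH] /=; first by rewrite subrr; apply: xbounded0.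
rewrite {1}/opX addrAC exprSr -mulrBl; apply: xboundedD; first exact: xbounded_x.
exact: xbounded_evy.
Qed.

(** Both X and right multiplication by x raise the x-degree by one with the same
    leading part, as their difference takes values in k[y]. *)
Lemma act1_triangular n a : xbounded n.+1 a -> xbounded n (act 1 a - a).
Proof.
move=> an; have {an} : forall j, leq (size (xycoef a)`_j) n.+1 by [].
rewrite -{2 3}[a]xycoefK; elim/poly_ind: (xycoef a) => [|u f IH] un.
  by rewrite raddf0 act0 subr0; apply: xbounded0.
rewrite raddfD /= xyvalMX xyvalC actD act_muly act_evx opprD addrACA -mulrBl.
apply: xboundedD.
  apply: xbounded_y; apply: IH => j.
  by have := un j.+1; rewrite coefD coefMX coefC /= addr0.
have := un 0%N; rewrite coefD coefMX coefC add0r => szf.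
have -> : ev x f = \sum_(i < size f) f`_i *: x ^+ i.
  rewrite -{1}[f]coefK poly_def raddf_sum; apply: eq_bigr => i _ /=.
  by rewrite evZ rmorphXn /= evX.
rewrite -sumrB; elim/big_rec: _ => [|i b _]; first exact: xbounded0.
apply: xboundedD; rewrite -scalerBr; apply: xboundedZ.
apply: xbounded_le (iter_opX_triangular i).
by rewrite -ltnS (leq_trans (ltn_ord i)).
Qed.

Lemma xbounded_eq0 a : xbounded 0 a -> a = 0.
Proof.
move=> a0; apply: eq_from_xycoef => j; rewrite raddf0 coef0.
by apply/eqP; rewrite -size_poly_leq0.
Qed.

Lemma xbounded_exists a : exists n, xbounded n a.
Proof.
elim/weyl_horner_ind: a => [|a f [n an]]; first by exists 0%N; apply: xbounded0.
exists (maxn n (size f)); apply: xboundedD.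
  by apply: xbounded_y; apply: xbounded_le an; apply: leq_maxl.
move=> j; rewrite xycoef_ev coefC; case: eqP; rewrite ?size_poly0 // => _.
exact: leq_maxr.
Qed.

(** A unitriangular map for an exhaustive filtration starting at 0. *)
Lemma act1_bij : bijective (act 1).
Proof.
have ker a : act 1 a = 0 -> a = 0.
  have [n an] := xbounded_exists a => a0.
  elim: n an => [|n IH] an; first exact: xbounded_eq0.
  apply: IH; have := act1_triangular an; rewrite a0 => an'.
  by rewrite -[a]subr0 -opprB -sub0r; apply: xboundedB; first exact: xbounded0.
have inj : injective (act 1).
  by move=> a b e; apply/subr0_eq/ker; rewrite actB e subrr.
have surj b : exists a, act 1 a = b.
  have [n bn] := xbounded_exists b.
  elim: n b bn => [|n IH] b bn; first by exists 0; rewrite act0 (xbounded_eq0 bn).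
  have [a e] := IH _ (act1_triangular bn).
  by exists (b - a); rewrite actB e subKr.
have [g gK] := choice surj.
by exists g => a //; apply: inj; rewrite gK.
Qed.

Lemma act_morph (r : M -> A) (rho : M -> kX) : almost_linear_embedding r rho ->
  (forall m, xi (r m) = rho m) -> forall m a, r (m <* a) = act (r m) a.
Proof.
move=> rP xi_r m a; have rD := aleD rP.
have r_opX n : r (n <* x) = opX (r n) by rewrite (ale_x rP) /opX xi_r.
have r_evx n f : r (n <* ev x f) = opX_eval (r n) f.
  elim/poly_ind: f n => [|f c IH] n; first by rewrite !raddf0 ract0 (ale0 rP).
  rewrite mulrC !raddfD /= rmorphM /= evX evC ractDr rD (aleZ rP) -ractA IH r_opX.
  by rewrite opX_eval_mulX opX_evalC.
elim/weyl_horner_ind: a => [|a f IH]; first by rewrite ract0 act0 (ale0 rP).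
by rewrite ractDr -ractA rD (ale_y rP) IH r_evx actD act_muly act_evx.
Qed.

End DeformedAction.

(** * The envelope *)

Lemma weyl_envelope_exists :
  exists (K : ainf_module A) (r : M -> K0 K), is_envelope x y r.
Proof.
have [r [rho rP]] := almost_linear_embedding_exists.
have [xi [xi_r xi_lin xi_y]] := defect_extension rP.
have r_act := act_morph rP xi_r.
pose N := in_range r.
have N_act u a : N u -> N (act xi u a) by move=> [m <-]; exists (m <* a).
have N_assoc u a b : N u -> act xi (act xi u a) b = act xi u (a * b).
  by move=> [m <-]; rewrite -!r_act ractA.
pose K := associator_module (act_linl xi_lin) (act_linr xi) (act1r xi)
  (in_range0 rP) (@in_range_lin _ _ rP) N_act N_assoc.
exists K, r; split; last first.
  split=> [c m n|m|m a|||v].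
  - by rewrite (aleD rP) -(aleZ rP).
  - by apply/(qproj_eq0 (in_range0 rP) (in_range_lin rP)); exists m.
  - exact: r_act.
  - exact: ale_inj rP.
  - by move=> u /(qproj_eq0 (in_range0 rP) (in_range_lin rP)).
  - by exists (qrep v); apply: qrepK.
split.
  have [I [e eP]] := ale_cofinite rP.
  exists #|I|, (fun i => m1 K (e (enum_val i))) => v.
  have [m [c qv]] := eP (qrep v).
  exists (fun i => c (enum_val i)).
  rewrite -[v]qrepK qv [LHS]raddfD /= [X in X + _](_ : _ = 0); last first.
    by apply/(qproj_eq0 (in_range0 rP) (in_range_lin rP)); exists m.
  rewrite add0r raddf_sum (reindex _ (onW_bij _ (enum_val_bij I))) /=.
  by apply: eq_bigr => i _; rewrite linearZ.
exists 1; split=> [|a v|a v|v].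
- exact: act1_bij.
- by rewrite /= /qassociator /associator act_mulx ?act_x ?subrr.
- by rewrite /= /qassociator /associator act_muly ?act_y ?subrr.
- exact: act_yx.
Qed.

End RankOneModule.

End WeylEnvelope.

(** * Generation of the Weyl algebra *)

Lemma weyl_ind (k : fieldType) (S : weyl k -> Prop) : S 1 ->
  (forall c a b, S a -> S b -> S (c *: a + b)) ->
  (forall a, S a -> S (a * weyl_x k)) -> (forall a, S a -> S (a * weyl_y k)) ->
  forall a, S a.
Proof.
move=> S1 Slin Sx Sy a.
have S0 : S 0 by have := Slin (-1) _ _ S1 S1; rewrite scaleN1r addNr.
pose mon (m : {fmonom bool}) : free2 k := (<< m >> : {malg k[{fmonom bool}]}).
pose q (u : free2 k) : weyl k := qpi (weyl_rel_proper k) u.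
have Sw (m : {fmonom bool}) b : S b -> S (b * q (mon m)).
  case: m => w; elim: w b => [|g w IH] b Sb.
    have -> : mon (FMonom [::]) = 1.
      by congr << _ >>; apply: val_inj; rewrite /= fm1.
    by rewrite [q _]qpi1 mulr1.
  have -> : mon (FMonom (g :: w)) = mon (fmu g) * mon (FMonom w).
    rewrite /mon [RHS]fgmulUU mulr1; congr << _ >>.
    by apply: val_inj; rewrite /= fmM fmU.
  rewrite [q _]qpiM mulrA; apply: IH.
  by case: g; [apply: Sy | apply: Sx].
have -> : a = q (qrepr a) by rewrite /q qreprK.
rewrite (_ : qrepr a = \sum_(m <- msupp (qrepr a : {malg k[{fmonom bool}]}))
  ((qrepr a : {malg k[{fmonom bool}]})@_m *: mon m : free2 k)); last first.
  rewrite [LHS]monalgE; apply: eq_bigr => m _.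
  by apply/malgP => m'; rewrite mcoeffZ !mcoeffU mulr_natr.
elim: (X in \sum_(m <- X) _) => [|m s IH]; first by rewrite big_nil [q _]qpi0.
rewrite big_cons [q _]qpiD [qpi _ (_ *: _)]qpiZ; apply: Slin => //.
by rewrite -[qpi _ _]mul1r; apply: Sw.
Qed.

Theorem theorem4 (k : closedFieldType) (char0 : [pchar k] =i pred0)
    (M : lmodType (weyl k)^c) (Mfg : finitely_generated M)
    (Mrank1 : has_rank M 1) (Mtf : torsion_free M) :
  exists (K : ainf_module (weyl k)) (r : M -> K0 K),
    is_envelope (weyl_x k) (weyl_y k) r.
Proof.
exact: (weyl_envelope_exists char0 (weyl_commutation k) (@weyl_ind k)
  Mtf Mfg Mrank1).
Qed.
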